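(* Let $n\ge2$ and let $\Omega\subset\mathbb R^n$ be a domain of diameter $R$ that is star-shaped with respect to a ball of radius $\rho$. Let $C^A,C^B>0$ be constants such that for every $f\in H^1_0(\Omega)\cap L^2_0(\Omega)$ there exists $\mathbf u\in[H^2_0(\Omega)]^n$ with $\nabla\cdot\mathbf u=f$ and $|\mathbf u|_{2,\Omega}\le C^A\|f\|_{0,\Omega}+C^B|f|_{1,\Omega}$; let $C_P>0$ be such that $\|f\|_{0,\Omega}\le C_PR\,|f|_{1,\Omega}$ for all $f\in H^1_0(\Omega)$. Define $$ C_{NL,1}:=\sup_{f\in H^{-1}(\Omega)/\mathbb R}\frac{\|f\|_{H^{-1}(\Omega)/\mathbb R}}{\|\nabla f\|_{-2,\Omega}},\qquad \beta_1:=\inf_{f\in H^{-1}(\Omega)/\mathbb R}\ \sup_{\mathbf u\in[H^2_0(\Omega)]^n}\frac{\langle f,\nabla\cdot\mathbf u\rangle}{\|f\|_{H^{-1}(\Omega)/\mathbb R}\,|\mathbf u|_{2,\Omega}}, $$ where $\langle\cdot,\cdot\rangle$ is the duality pairing between $H^{-1}(\Omega)$ and $H^1_0(\Omega)$, and supremum and infimum are over nonzero elements. Then $$ C^A C_P R+C^B\ \ge\ C_{NL,1}=\beta_1^{-1}. $$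
   Context: Star-shaped with respect to a ball $B$: for every $x\in\Omega$, $y\in B$ the segment joining $x$ and $y$ lies in $\Omega$. $\|\cdot\|_{0,\Omega}$ is the $L^2(\Omega)$ norm; $|\cdot|_{s,\Omega}$ is the $H^s(\Omega)$ seminorm (the $L^2$ norm of all derivatives of order $s$), also for vector fields. $H^s_0(\Omega)$ is the closure of $\mathcal C_0^\infty(\Omega)$ in $H^s(\Omega)$; $L^2_0(\Omega)$ is the space of zero-average $L^2(\Omega)$ functions. For $\ell=1,2$, $H^{-\ell}(\Omega)=[H^\ell_0(\Omega)]^*$ with norm $\|u\|_{-\ell,\Omega}:=\sup_{v\in H^\ell_0(\Omega)\setminus\{0\}}\langle u,v\rangle/|v|_{\ell,\Omega}$ (and similarly for vector-valued distributions). $H^{-1}(\Omega)/\mathbb R$ is $H^{-1}(\Omega)$ modulo constants, with norm $\|f\|_{H^{-1}(\Omega)/\mathbb R}:=\inf_{c\in\mathbb R}\|f-c\|_{-1,\Omega}$. $\nabla f$ is the distributional gradient. *)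

(* Defs.v *)
From HB Require Import structures.
From mathcomp Require Import all_boot all_order all_algebra.
From mathcomp Require Import all_classical all_reals all_analysis.

Set Implicit Arguments.
Unset Strict Implicit.
Unset Printing Implicit Defensive.
Import Order.TTheory GRing.Theory Num.Theory.
Import numFieldNormedType.Exports.

Local Open Scope classical_set_scope.
Local Open Scope ring_scope.

(* The sigma-algebra on R^n = 'rV[R]_n generated by the coordinates, i.e. the
   Borel sigma-algebra. *)
Definition measure_rV_display : measure_display.
Proof. exact: default_measure_display. Qed.

Section measurable_rV.
Context {R : realType} {n : nat}.

Let coors (i : 'I_n) (x : 'rV[R]_n) : measurableTypeR R := x 0 i.

Let rV_set0 : g_sigma_preimage coors set0.
Proof. exact: sigma_algebra0. Qed.

Let rV_setC A : g_sigma_preimage coors A -> g_sigma_preimage coors (~` A).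
Proof. exact: sigma_algebraC. Qed.

Let rV_bigcup (F : _^nat) : (forall i, g_sigma_preimage coors (F i)) ->
  g_sigma_preimage coors (\bigcup_i (F i)).
Proof. exact: sigma_algebra_bigcup. Qed.

HB.instance Definition _ := @isMeasurable.Build measure_rV_display
  'rV[R]_n (g_sigma_preimage coors) rV_set0 rV_setC rV_bigcup.

End measurable_rV.

Lemma measurable_rV_coord (R : realType) n (i : 'I_n) :
  measurable_fun [set: 'rV[R]_n] (fun x => x 0 i : measurableTypeR R).
Proof.
move=> _ Y mY; rewrite setTI; apply: sub_sigma_algebra => /=.
rewrite -bigcup_seq/=; exists i => /=; first by rewrite mem_index_enum.
by exists Y => //; rewrite setTI.
Qed.

Lemma measurable_fun_rV d (T : measurableType d) (R : realType) n
    (f : T -> 'rV[R]_n) :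
  (forall i, measurable_fun [set: T] (fun t => f t 0 i : measurableTypeR R)) ->
  measurable_fun [set: T] f.
Proof.
move=> mf _ Y mY; rewrite setTI; move: Y mY.
suff: @measurable _ 'rV[R]_n `<=` image_set_system setT f measurable.
  by move=> h Y /h; rewrite /image_set_system /= setTI.
apply: smallest_sub.
  by apply: sigma_algebra_image; exact: sigma_algebra_measurable.
move=> A; rewrite -bigcup_seq/= => -[i _ [B mB <-]].
by rewrite /image_set_system/= !setTI -[X in measurable X]setTI; exact: mf.
Qed.

Definition rV_cons (R : realType) n (p : measurableTypeR R * 'rV[R]_n) :
    'rV[R]_n.+1 :=
  \row_(i < n.+1) oapp (fun j => p.2 0 j) p.1 (unlift ord0 i).

Definition rV_uncons (R : realType) n (x : 'rV[R]_n.+1) :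
    measurableTypeR R * 'rV[R]_n :=
  (x 0 ord0, \row_(i < n) x 0 (lift ord0 i)).

Lemma rV_consK (R : realType) n : cancel (@rV_cons R n) (@rV_uncons R n).
Proof.
move=> [a v]; rewrite /rV_uncons mxE unlift_none/=; congr pair.
by apply/rowP => i; rewrite !mxE liftK.
Qed.

Lemma measurable_rV_cons (R : realType) n :
  measurable_fun setT (@rV_cons R n).
Proof.
apply: measurable_fun_rV => i.
under eq_fun do rewrite mxE.
case: (unlift ord0 i) => [j|] /=; last exact: measurable_fst.
exact: (measurableT_comp (measurable_rV_coord j) measurable_snd).
Qed.

Lemma measurable_rV_uncons (R : realType) n :
  measurable_fun setT (@rV_uncons R n).
Proof.
apply: measurable_fun_pair; first exact: measurable_rV_coord.
apply: measurable_fun_rV => i; under eq_fun do rewrite mxE.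
exact: measurable_rV_coord.
Qed.

(* Lebesgue measure on R^n, as an n-fold product. *)
Fixpoint leb (R : realType) (n : nat) : set 'rV[R]_n -> \bar R :=
  if n is m.+1 return set 'rV[R]_n -> \bar R then
    pushforward (lebesgue_measure \x @leb R m)%E (@rV_cons R m)
  else \d_(0 : 'rV[R]_0).

Section leb_succ.
Context (R : realType) (n : nat).
Variable mu : {sigma_finite_measure set 'rV[R]_n -> \bar R}.

Definition leb_succ : set 'rV[R]_n.+1 -> \bar R :=
  pushforward (lebesgue_measure \x mu)%E (@rV_cons R n).

Let leb_succ0 : leb_succ set0 = 0%E.
Proof. by rewrite /leb_succ /pushforward preimage_set0 measure0. Qed.

Let leb_succ_ge0 A : (0 <= leb_succ A)%E.
Proof. by rewrite /leb_succ /pushforward measure_ge0. Qed.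

Let leb_succ_sigma_additive : semi_sigma_additive leb_succ.
Proof.
have mc := @measurable_rV_cons R n.
move=> F mF tF mUF; rewrite /leb_succ /pushforward preimage_bigcup.
apply: measure_semi_sigma_additive.
- by move=> k; rewrite -[X in measurable X]setTI; exact: mc.
- apply/trivIsetP => /= i j _ _ ij; rewrite -preimage_setI.
  by move/trivIsetP : tF => /(_ _ _ _ _ ij) ->//; rewrite preimage_set0.
- by rewrite -preimage_bigcup -[X in measurable X]setTI; exact: mc.
Qed.

HB.instance Definition _ := isMeasure.Build _ _ _ leb_succ
  leb_succ0 leb_succ_ge0 leb_succ_sigma_additive.

Let leb_succ_sigma_finite : sigma_finite setT leb_succ.
Proof.
have /sigma_finiteP[F [TF ndF Foo]] := sigma_finiteT (@lebesgue_measure R).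
have /sigma_finiteP[G [TG ndG Goo]] := sigma_finiteT mu.
exists (fun k => @rV_uncons R n @^-1` (F k `*` G k)).
  rewrite -preimage_bigcup (_ : \bigcup_k (F k `*` G k) = setT)//.
  rewrite -setXTT TF TG predeqE => -[x y]; split.
    by move=> [k _ []/= ? ?]; split; exists k.
  move=> [/= [k _ Fkx] [l _ Gly]]; exists (maxn k l) => //; split.
  - by move: x Fkx; exact/subsetPset/ndF/leq_maxl.
  - by move: y Gly; exact/subsetPset/ndG/leq_maxr.
move=> k; have [mFk Fk] := Foo k; have [mGk Gk] := Goo k; split.
  rewrite -[X in measurable X]setTI; apply: measurable_rV_uncons => //.
  exact: measurableX.
rewrite /leb_succ /pushforward -comp_preimage.
rewrite (_ : _ @^-1` (F k `*` G k) = F k `*` G k).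
  by rewrite product_measure1E// lte_mul_pinfty// ge0_fin_numE.
by apply/seteqP; split => p; rewrite /preimage /comp /mkset rV_consK.
Qed.

HB.instance Definition _ := @Measure_isSigmaFinite.Build _ _ _ leb_succ
  leb_succ_sigma_finite.

End leb_succ.

Section leb_measure.
Context (R : realType) (n : nat).

Let leb_sigma_finite_measure :
  exists mu : {sigma_finite_measure set 'rV[R]_n -> \bar R}, @leb R n = mu.
Proof.
elim: n => [|m [mu IH]]; first by exists \d_(0 : 'rV[R]_0).
by exists (leb_succ mu); rewrite /= IH.
Qed.

Let leb0 : @leb R n set0 = 0%E.
Proof. by have [mu ->] := leb_sigma_finite_measure; exact: measure0. Qed.

Let leb_ge0 A : (0 <= @leb R n A)%E.
Proof. by have [mu ->] := leb_sigma_finite_measure; exact: measure_ge0. Qed.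

Let leb_sigma_additive : semi_sigma_additive (@leb R n).
Proof.
have [mu ->] := leb_sigma_finite_measure.
exact: measure_semi_sigma_additive.
Qed.

HB.instance Definition _ := isMeasure.Build _ _ _ (@leb R n)
  leb0 leb_ge0 leb_sigma_additive.

Let leb_sigma_finite : sigma_finite setT (@leb R n).
Proof.
by have [mu ->] := leb_sigma_finite_measure; exact: sigma_finiteT.
Qed.

HB.instance Definition _ := @Measure_isSigmaFinite.Build _ _ _ (@leb R n)
  leb_sigma_finite.

End leb_measure.
Arguments leb : clear implicits.

Section geometry.
Context (R : realType) (n : nat).
Implicit Types (Omega : set 'rV[R]_n) (x y : 'rV[R]_n).

(* The library's norm on 'rV[R]_n is the maximum norm. *)
Definition eucl_norm x : R := Num.sqrt (\sum_(i < n) x 0 i ^+ 2).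

Definition diameter Omega : \bar R :=
  ereal_sup [set (eucl_norm (x - y))%:E | x in Omega & y in Omega].

Definition star_shaped_wrt_ball Omega (c : 'rV[R]_n) (rho : R) : Prop :=
  forall x y t, Omega x -> eucl_norm (y - c) < rho -> 0 <= t <= 1 ->
    Omega ((1 - t) *: x + t *: y).

Definition domain Omega : Prop := [/\ open Omega, connected Omega & Omega !=set0].

End geometry.

Section derivatives.
Context (R : realType) (n : nat).
Implicit Types (Omega : set 'rV[R]_n) (phi psi : 'rV[R]_n -> R).

Definition partials (w : seq 'I_n) phi : 'rV[R]_n -> R :=
  foldr (fun i g => 'D_('e_i) g) phi w.

Definition smooth phi : Prop := forall w : seq 'I_n,
  continuous (partials w phi) /\
  forall (x : 'rV[R]_n) (i : 'I_n), derivable (partials w phi) x 'e_i.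

(* C_0^oo(Omega), extended by zero outside Omega *)
Definition test_function Omega phi : Prop :=
  [/\ smooth phi, compact (closure [set x | phi x != 0]) &
      closure [set x | phi x != 0] `<=` Omega].

Definition multiindex : Type := {ffun 'I_n -> nat}.

Definition mi0 : multiindex := [ffun=> 0%N].

Definition mi_succ (a : multiindex) (i : 'I_n) : multiindex :=
  [ffun j => (a j + (j == i))%N].

Definition mi_order (a : multiindex) : nat := (\sum_(i < n) a i)%N.

Definition mi_deriv (a : multiindex) phi : 'rV[R]_n -> R :=
  partials (flatten [seq nseq (a i) i | i <- enum 'I_n]) phi.

End derivatives.
Arguments mi0 {n}.

Section sobolev.
Context (R : realType) (n : nat).
Variable Omega : set 'rV[R]_n.

(* L^2(Omega) and its norm, through the extension by zero *)
Definition L2 (f : 'rV[R]_n -> R) : Prop := f \_ Omega \in Lfun (leb R n) 2%:E.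

Definition L2norm (f : 'rV[R]_n -> R) : R :=
  fine ('N[leb R n]_2%:E[EFin \o (f \_ Omega)])%E.

Definition weak_derivative (a : multiindex n) (f g : 'rV[R]_n -> R) : Prop :=
  forall psi, test_function Omega psi ->
    \int[leb R n]_(x in Omega) (f x * mi_deriv a psi x) =
    (-1) ^+ mi_order a * \int[leb R n]_(x in Omega) (g x * psi x).

(* A Sobolev function is given together with its weak derivatives: u a stands
   for D^a u, and u mi0 is the function itself. Since weak derivatives are
   unique up to null sets, this only adds a choice of representatives. In
   H^s(Omega) the components of order greater than s are irrelevant. *)
Definition jet : Type := multiindex n -> 'rV[R]_n -> R.

Definition jet_of (phi : 'rV[R]_n -> R) : jet := fun a => mi_deriv a phi.

Definition sobolev (s : nat) (u : jet) : Prop :=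
  forall a, (mi_order a <= s)%N -> L2 (u a) /\ weak_derivative a (u mi0) (u a).

(* The sum runs over all multi-indices of order s; their entries are at most
   s. *)
Definition seminorm (s : nat) (u : jet) : R :=
  Num.sqrt (\sum_(a : {ffun 'I_n -> 'I_s.+1} | (\sum_(i < n) a i)%N == s)
    L2norm (u [ffun i => a i : nat]) ^+ 2).

Definition sobolev_norm (s : nat) (u : jet) : R :=
  Num.sqrt (\sum_(k < s.+1) seminorm k u ^+ 2).

(* H^s_0(Omega), the closure of C_0^oo(Omega) in H^s(Omega) *)
Definition sobolev0 (s : nat) (u : jet) : Prop :=
  sobolev s u /\
  forall e, 0 < e -> exists2 phi, test_function Omega phi &
    sobolev_norm s (fun a x => u a x - jet_of phi a x) < e.

Definition nonzero (u : jet) : Prop := L2norm (u mi0) != 0.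

Definition zero_mean (u : jet) : Prop := \int[leb R n]_(x in Omega) u mi0 x = 0.

Definition vsobolev0 (s : nat) (u : 'I_n -> jet) : Prop :=
  forall i, sobolev0 s (u i).

Definition vseminorm (s : nat) (u : 'I_n -> jet) : R :=
  Num.sqrt (\sum_(i < n) seminorm s (u i) ^+ 2).

Definition vnonzero (u : 'I_n -> jet) : Prop := exists i, nonzero (u i).

Definition divergence (u : 'I_n -> jet) : jet :=
  fun a x => \sum_(i < n) u i (mi_succ a i) x.

(* H^-s(Omega), the dual of H^s_0(Omega); the values of a functional outside
   H^s_0(Omega) are irrelevant. The application f v is the duality pairing. *)
Definition dual_sobolev (s : nat) (f : jet -> R) : Prop :=
  (forall (c : R) (u v : jet), sobolev0 s u -> sobolev0 s v ->
     f (fun a x => c * u a x + v a x) = c * f u + f v) /\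
  exists C : R, forall v, sobolev0 s v -> `|f v| <= C * sobolev_norm s v.

Definition dual_norm (s : nat) (f : jet -> R) : \bar R :=
  ereal_sup [set ((f v)%:E / (seminorm s v)%:E)%E
            | v in [set v | sobolev0 s v /\ nonzero v]].

Definition vdual_norm (s : nat) (F : ('I_n -> jet) -> R) : \bar R :=
  ereal_sup [set ((F u)%:E / (vseminorm s u)%:E)%E
            | u in [set u | vsobolev0 s u /\ vnonzero u]].

Definition constant_functional (c : R) : jet -> R :=
  fun v => \int[leb R n]_(x in Omega) (c * v mi0 x).

(* f is nonzero in H^-1(Omega)/R *)
Definition nonconstant (f : jet -> R) : Prop :=
  ~ exists c, forall v, sobolev0 1 v -> f v = constant_functional c v.

Definition quotient_norm (f : jet -> R) : \bar R :=
  ereal_inf [set dual_norm 1 (fun v => f v - constant_functional c v)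
            | c in [set: R]].

(* The distributional gradient of f in H^-1(Omega), as a functional on
   H^2_0(Omega)^n. *)
Definition gradient (f : jet -> R) : ('I_n -> jet) -> R :=
  fun u => - f (divergence u).

Definition C_NL1 : \bar R :=
  ereal_sup [set (quotient_norm f / vdual_norm 2 (gradient f))%E
            | f in [set f | dual_sobolev 1 f /\ nonconstant f]].

Definition beta1 : \bar R :=
  ereal_inf [set ereal_sup
      [set ((f (divergence u))%:E / (quotient_norm f * (vseminorm 2 u)%:E))%E
      | u in [set u | vsobolev0 2 u /\ vnonzero u]]
    | f in [set f | dual_sobolev 1 f /\ nonconstant f]].

End sobolev.

(* Main.v *)
Require Import Defs.
From mathcomp Require Import all_boot all_order all_algebra.
From mathcomp Require Import all_classical all_reals all_analysis.
From mathcomp Require Import measurable_realfun ring lra.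
Import Order.TTheory GRing.Theory Num.Theory.
Import numFieldNormedType.Exports.
Local Open Scope classical_set_scope.
Local Open Scope ring_scope.

Set Implicit Arguments.
Unset Strict Implicit.
Unset Printing Implicit Defensive.

(** For f in H^-1, put q = inf_c |f - c|_{-1} and N = |grad f|_{-2}. If v in
    H^1_0 has zero mean, then v = div u with |u|_2 <= K |v|_1, where
    K = C^A C_P R + C^B, hence |f v| = |<grad f, u>| <= N K |v|_1. The
    zero-mean functions form a hyperplane of H^1_0, and a one-dimensional
    Hahn-Banach extension across it produces a constant c with
    |f - c|_{-1} <= N K; thus q <= K N. Both C_NL1 = sup q / N and
    1 / beta_1 = 1 / inf (N / q) are then the same supremum.

    The identity needs some non-constant f, since otherwise C_NL1 would be
    the supremum -oo of the empty set and 1 / beta_1 would be 1 / +oo = 0;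
    such an f is obtained by integration against one of two bump functions
    with disjoint supports. *)

(** * Smooth functions and test functions *)

(** Two features of the setting shape the argument. A functional acts on jets, that is, on
    representatives together with their derivatives, so f v = f (div u) does not follow at once from
    div u = v almost everywhere. It takes [dual_null]: an element of H^-1 vanishes on every jet of
    H^1_0 whose order-zero component is null. Moreover the ratios live in [\bar R], where q / N is
    the inverse of N / q only once 0 < q < +oo and 0 < N are known. Finiteness of q comes from the
    Poincaré inequality; both positivity statements come from the extension with bound 0, by which f
    is a constant as soon as it vanishes on zero-mean functions. The value N = +oo is allowed and
    gives 0 on both sides. Boundedness of Omega, read off from the diameter, makes the mean a finite
    linear functional on L^2. The analysis on R^n is there to place derivatives in H^1_0 and to
    build the bumps: [mi_deriv] fixes an order of differentiation, hence the symmetry of partial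
    derivatives, and a test function is in H^1_0 only after an integration by parts. *)

Section flat.
Context {R : realType}.
Implicit Types (p : {poly R}) (x y : R).

(** The polynomial factor makes the family closed under differentiation; [flat 1] is the classical
    function exp(-1/x). *)
Definition flat p x : R :=
  if 0 < x then p.[x^-1] * expR (- x^-1) else 0.

Lemma flat_gt0 p x : 0 < x -> flat p x = p.[x^-1] * expR (- x^-1).
Proof. by rewrite /flat => ->. Qed.

Lemma flat_le0 p x : x <= 0 -> flat p x = 0.
Proof. by rewrite /flat ltNge => ->. Qed.

Lemma horner_bound p y : 1 <= y ->
  `|p.[y]| <= (\sum_(i < size p) `|p`_i|) * y ^+ size p.
Proof.
move=> y1; rewrite horner_coef (le_trans (ler_norm_sum _ _ _))//.
rewrite mulr_suml ler_sum// => i _; rewrite normrM normrX ler_wpM2l//.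
by rewrite ger0_norm ?(le_trans ler01)// ler_weXn2l// ltnW.
Qed.

(** With y = 1/x >= 1, p(y) is at most A y^(size p), while exp y >= y^m / m! for m = size p + 2. The
    two spare powers of y are the factor x^2, which yields a zero derivative at 0. *)
Lemma flat_quadratic p : exists C, forall x, x < 1 -> `|flat p x| <= C * x ^+ 2.
Proof.
pose A : R := \sum_(i < size p) `|p`_i|; pose m := (size p).+2.
have A0 : 0 <= A by exact: sumr_ge0.
exists (A * (m`!)%:R) => x x1; have [x0|x0] := ltP 0 x; last first.
  by rewrite flat_le0// normr0 mulr_ge0 ?sqr_ge0// mulr_ge0.
rewrite flat_gt0// normrM (ger0_norm (expR_ge0 _)) expRN.
have y1 : 1 <= x^-1 by rewrite invf_ge1// ltW.
set y := x^-1 in y1 *; have y0 : 0 < y by rewrite invr_gt0.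
have -> : x = y^-1 by rewrite invrK.
have ey : y ^+ m <= (m`!)%:R * expR y.
  have := @expR_ge1Dxn _ y m.-1 (ltW y0); rewrite /= -/m => h.
  rewrite -ler_pdivrMl ?ltr0n ?fact_gt0// mulrC.
  by apply: le_trans h; rewrite lerDr.
rewrite ler_pdivrMr ?expR_gt0// (le_trans (horner_bound _ y1))//.
rewrite -/A -!mulrA ler_wpM2l//.
rewrite -(ler_pM2l (exprn_gt0 2 y0)) -exprD (le_trans ey)//.
by rewrite le_eqVlt; apply/orP; left; apply/eqP; field; rewrite gt_eqF.
Qed.

Lemma is_derive_flat p x :
  is_derive x 1 (flat p) (flat ('X^2 * (p - p^`())) x).
Proof.
have [x0|x0|<-] := ltgtP 0 x.
- apply: (@near_eq_is_derive R R R
      (fun z => p.[z^-1] * expR (- z^-1))).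
    near=> z; rewrite flat_gt0//; near: z.
    exact: lt_nbhsr.
  rewrite flat_gt0//.
  have dV : is_derive x 1 (fun z : R => z^-1) (- x ^- 2 *: 1).
    by apply: (@is_deriveV _ id) => //; rewrite gt_eqF.
  have dp := is_derive1_comp (is_derive_poly p x^-1) dV.
  have de := @is_derive1_comp R expR (fun z => - z^-1) x _ _
    (is_derive_expR _) (is_deriveN dV).
  apply: is_derive_eq (is_deriveM dp de) _.
  rewrite /= !hornerE /GRing.scale/= -?exprVn.
  ring.
- apply: (@near_eq_is_derive R R R (cst 0)).
    near=> z; rewrite flat_le0//; apply: ltW; near: z.
    exact: lt_nbhsl.
  by rewrite flat_le0 ?(ltW x0)//; exact: is_derive_cst.
(* At 0 the quadratic bound leaves a difference quotient of size at most |C| |h|; the 1 added to |C|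
   keeps the divisor positive. *)
rewrite flat_le0//; have [C Cp] := flat_quadratic p.
have cv : h^-1 *: ((flat p \o shift 0) (h *: (1 : R)) - flat p 0)
    @[h --> 0^'] --> (0 : R).
  apply/cvgr0Pnorm_lt => e e0; near=> h.
  have h0 : h != 0 by near: h; exact: nbhs_dnbhs_neq.
  rewrite /= addr0 (flat_le0 _ (lexx 0)) subr0 normrZ normfV.
  rewrite ltr_pdivrMl ?normr_gt0// /GRing.scale/= mulr1.
  have h1 : `|h| < 1.
    by near: h; apply: dnbhs0_lt.
  have he : `|h| < e / (`|C| + 1).
    by near: h; apply: dnbhs0_lt; rewrite divr_gt0// ltr_wpDl.
  have hh : h < 1 by rewrite (le_lt_trans (ler_norm _)).
  apply: (le_lt_trans (Cp _ hh)).
  rewrite -normr_id -[h ^+ 2]ger0_norm ?sqr_ge0// normrX.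
  apply: (le_lt_trans (ler_wpM2r _ (ler_norm C))); first exact: sqr_ge0.
  rewrite expr2 normr_id mulrCA ltr_pM2l ?normr_gt0//.
  apply: (@le_lt_trans _ _ ((`|C| + 1) * `|h|)).
    by rewrite ler_wpM2r// lerDl.
  by rewrite mulrC -ltr_pdivlMr// ltr_wpDl.
by split; [apply/cvg_ex; exists 0|exact: (cvg_lim _ cv)].
Unshelve. all: by end_near. Qed.

End flat.

(** * Functions of class C^k and their products *)

Section Ck.
Context {R : realType} {n : nat}.
Implicit Types (phi psi : 'rV[R]_n -> R) (i j : 'I_n).

(** The recursion on the order is what lets products through: both terms of the product rule are
    products of functions of the lower class. [smooth], stated on iterated partials, offers no such
    induction. *)
Fixpoint Ck k phi : Prop :=
  continuous phi /\
  if k is l.+1 then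
    forall i, (forall x, derivable phi x 'e_i) /\ Ck l ('D_('e_i) phi)
  else True.

Lemma CkS k phi : Ck k.+1 phi -> Ck k phi.
Proof.
elim: k phi => [|k IH] phi [cphi dphi]; split => // i.
by have [dphi_i /IH] := dphi i.
Qed.

Lemma CkD k phi psi : Ck k phi -> Ck k psi -> Ck k (phi \+ psi).
Proof.
elim: k phi psi => [|k IH] phi psi [cphi dphi] [cpsi dpsi]; split => //.
- by move=> x; apply: continuousD; [exact: cphi|exact: cpsi].
- by move=> x; apply: continuousD; [exact: cphi|exact: cpsi].
move=> i; have [d1 k1] := dphi i; have [d2 k2] := dpsi i; split.
  by move=> x; exact: derivableD.
have -> : 'D_('e_i) (phi \+ psi) = 'D_('e_i) phi \+ 'D_('e_i) psi.
  by apply/funext => x; exact: deriveD.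
exact: IH.
Qed.

Lemma CkM k phi psi : Ck k phi -> Ck k psi -> Ck k (phi \* psi).
Proof.
elim: k phi psi => [|k IH] phi psi hphi hpsi.
  by split=> // x; apply: continuousM; [exact: hphi.1|exact: hpsi.1].
split; first by move=> x; apply: continuousM; [exact: hphi.1|exact: hpsi.1].
move=> i; have [d1 k1] := hphi.2 i; have [d2 k2] := hpsi.2 i; split.
  by move=> x; exact: derivableM.
have -> : 'D_('e_i) (phi \* psi) =
    (phi \* 'D_('e_i) psi) \+ (psi \* 'D_('e_i) phi).
  by apply/funext => x; exact: deriveM.
by apply: CkD; apply: IH => //; exact: CkS.
Qed.

Lemma Ck_cst k (a : R) : Ck k (cst a).
Proof.
elim: k a => [|k IH] a; split => //; try by move=> x; exact: cst_continuous.
move=> i; split; first by move=> x; exact: derivable_cst.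
have -> : 'D_('e_i) (cst a : 'rV[R]_n -> R) = cst 0.
  by apply/funext => x; exact: derive_cst.
exact: IH.
Qed.

Lemma Ck_prod k I (r : seq I) (F : I -> 'rV[R]_n -> R) :
  (forall a, Ck k (F a)) -> Ck k (fun x => \prod_(a <- r) F a x).
Proof.
move=> CF; elim: r => [|a r IH].
  under eq_fun do rewrite big_nil; exact: Ck_cst.
under eq_fun do rewrite big_cons; exact: CkM.
Qed.

Lemma is_derive_coord (g : R -> R) dg i j (x : 'rV[R]_n) :
  is_derive (x 0 i) 1 g dg ->
  is_derive x 'e_j (fun y : 'rV[R]_n => g (y 0 i)) ((i == j)%:R * dg).
Proof.
move=> [dg1 dgE]; have [<-{j}|ij] := eqVneq i j; last first.
  have E : (fun h : R => h^-1 *: (((fun y : 'rV[R]_n => g (y 0 i)) \o shift x)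
      (h *: 'e_j) - g (x 0 i))) = cst 0.
    apply/funext => h; rewrite /= !mxE eqxx/= (negbTE ij).
    by rewrite mulr0 add0r subrr scaler0.
  by split; rewrite /derivable/derive E ?mul0r; [exact: is_cvg_cst|exact: lim_cst].
have E : (fun h : R => h^-1 *: (((fun y : 'rV[R]_n => g (y 0 i)) \o shift x)
      (h *: 'e_i) - g (x 0 i))) =
    (fun h : R => h^-1 *: ((g \o shift (x 0 i)) (h *: 1) - g (x 0 i))).
  by apply/funext => h; rewrite /= !mxE !eqxx.
by split; rewrite /derivable/derive E ?mul1r.
Qed.

(** The induction runs over all p at once, since each derivative replaces p by X^2 (p - p'). The
    slopes 1 and -1 give the two one-sided cut-offs of [bump]. *)
Lemma Ck_flat k p (s t : R) i : Ck k (fun x => flat p (s * x 0 i + t)).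
Proof.
have dF (q : {poly R}) (y : R) :
    is_derive y (1 : R) (fun z : R => flat q (s * z + t))
      (s * flat ('X^2 * (q - q^`())) (s * y + t)).
  have d : is_derive y (1 : R) (fun z : R => s * z + t) s.
    by apply: is_derive_eq; rewrite addr0 /GRing.scale/= mulr1.
  have := @is_derive1_comp R (flat q) (fun z => s * z + t) y _ _
    (is_derive_flat q _) d.
  by rewrite mulrC.
have cF q : continuous (fun x : 'rV[R]_n => flat q (s * x 0 i + t)).
  move=> x; apply: (@continuous_comp _ _ _ (fun x : 'rV[R]_n => x 0 i)
    (fun z => flat q (s * z + t))); first exact: coord_continuous.
  by apply/differentiable_continuous/derivable1_diffP; have [] := dF q (x 0 i).
elim: k p => [|k IH] p; split => // j; split => [x|].
  by have [] := is_derive_coord j (dF p (x 0 i)).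
have -> : 'D_('e_j) (fun x : 'rV[R]_n => flat p (s * x 0 i + t)) =
    (cst ((i == j)%:R * s)) \*
    (fun x : 'rV[R]_n => flat ('X^2 * (p - p^`())) (s * x 0 i + t)).
  apply/funext => x; have [_ ->] := is_derive_coord j (dF p (x 0 i)).
  by rewrite mulrA.
by apply: CkM => //; exact: Ck_cst.
Qed.

Lemma Ck_smooth phi : (forall k, Ck k phi) -> smooth phi.
Proof.
move=> Cphi w; suff : forall k, Ck k (partials w phi).
  by move=> /(_ 1%N) [? h]; split => // x i; exact: (h i).1.
by elim: w => [//|i w IH] k; have [_ /(_ i) []] := IH k.+1.
Qed.

End Ck.

(** * Symmetry of mixed partial derivatives *)

Section schwarz.
Context {R : realType} {n : nat}.
Implicit Types (phi : 'rV[R]_n -> R) (x v : 'rV[R]_n) (i j : 'I_n).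

Lemma is_derive_line phi x v (t : R) : derivable phi (x + t *: v) v ->
  is_derive t (1 : R) (fun s : R => phi (x + s *: v)) ('D_v phi (x + t *: v)).
Proof.
move=> d.
have E : (fun h : R => h^-1 *: (((fun s : R => phi (x + s *: v)) \o shift t)
      (h *: 1) - phi (x + t *: v))) =
    (fun h : R => h^-1 *: ((phi \o shift (x + t *: v)) (h *: v)
      - phi (x + t *: v))).
  by apply/funext => h; rewrite /= [h%:A]mulr1 scalerDl addrCA.
by split; rewrite /derivable /derive E.
Qed.

(** The mean value theorem is applied twice: along e_i to the increment [g], then along e_j to the
    partial derivative. The point found is x + a e_i + b e_j with a and b in [0, h], whence the
    distance 2 h in the maximum norm. *)
Lemma second_difference phi i j x (h : R) : 0 < h ->
  (forall y k, derivable phi y 'e_k) ->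
  (forall y, derivable ('D_('e_i) phi) y 'e_j) ->
  exists y, `|y - x| <= 2 * h /\
    phi (x + h *: 'e_i + h *: 'e_j) - phi (x + h *: 'e_i)
      - phi (x + h *: 'e_j) + phi x = h * h * 'D_('e_j) ('D_('e_i) phi) y.
Proof.
move=> h0 d1 d2.
pose g (s : R) := phi (x + h *: 'e_j + s *: 'e_i) - phi (x + s *: 'e_i).
pose dg (s : R) := 'D_('e_i) phi (x + h *: 'e_j + s *: 'e_i)
  - 'D_('e_i) phi (x + s *: 'e_i).
have gE s : is_derive s (1 : R) g (dg s).
  by apply: is_deriveB; apply: is_derive_line; exact: d1.
have cont (f df : R -> R) : (forall s, is_derive s (1 : R) f (df s)) ->
    {within `[0, h], continuous f}.
  move=> fE; apply: continuous_subspaceT => s.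
  by apply/differentiable_continuous/derivable1_diffP; have [] := fE s.
have [a ain ga] := MVT_segment (ltW h0) (fun s _ => gE s) (cont _ _ gE).
pose y0 := x + a *: 'e_i.
have kE s : is_derive s (1 : R) (fun s => 'D_('e_i) phi (y0 + s *: 'e_j))
    ('D_('e_j) ('D_('e_i) phi) (y0 + s *: 'e_j)).
  by apply: is_derive_line; exact: d2.
have [b bin kb] := MVT_segment (ltW h0) (fun s _ => kE s) (cont _ _ kE).
exists (y0 + b *: 'e_j); split.
  have nb c k : c \in `[0, h] -> `|c *: ('e_k : 'rV[R]_n)| <= h.
    rewrite in_itv/= => /andP[c0 ch].
    rewrite [leLHS]mx_normrE; apply/bigmax_leP; split; first exact: ltW.
    move=> [p q] _ /=; rewrite !mxE normrM (ger0_norm c0).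
    by case: andP => _; rewrite ?normr1 ?normr0 ?mulr1 ?mulr0// ltW.
  rewrite /y0 addrAC [x + _]addrC addrK mulr_natl mulr2n.
  by rewrite (le_trans (ler_normD _ _))// lerD ?nb.
have E : g h - g 0 = h * dg a by rewrite ga subr0 mulrC.
have E2 : dg a = h * 'D_('e_j) ('D_('e_i) phi) (y0 + b *: 'e_j).
  rewrite mulrC -[X in _ * X]subr0 -kb /dg scale0r addr0.
  by rewrite /y0 [x + a *: _ + _]addrAC.
rewrite -mulrA -E2 -E /g !scale0r !addr0 addrAC.
rewrite [x + _ + _]addrAC; ring.
Qed.

(** The second difference is symmetric in i and j, so the two mixed derivatives take a common value
    at two points near x. If they differed at x, continuity would put that value at less than half
    their distance from each of them. *)
Lemma derive_comm phi i j x :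
  (forall y k, derivable phi y 'e_k) ->
  (forall y k l, derivable ('D_('e_k) phi) y 'e_l) ->
  continuous ('D_('e_i) ('D_('e_j) phi)) ->
  continuous ('D_('e_j) ('D_('e_i) phi)) ->
  'D_('e_i) ('D_('e_j) phi) x = 'D_('e_j) ('D_('e_i) phi) x.
Proof.
move=> d1 d2 cA cB; apply/eqP/negP => /negP neq.
set A := 'D_('e_i) _ in cA neq; set B := 'D_('e_j) ('D_('e_i) _) in cB neq.
have e0 : 0 < `|A x - B x| / 2 by rewrite divr_gt0// normr_gt0 subr_eq0.
have /cvgrPdist_lt/(_ _ e0)/nbhs_normP[d1' /= d10 hA] := cA x.
have /cvgrPdist_lt/(_ _ e0)/nbhs_normP[d2' /= d20 hB] := cB x.
have m0 : 0 < Num.min d1' d2' by rewrite lt_min d10.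
pose h := Num.min d1' d2' / 4.
have h0 : 0 < h by rewrite divr_gt0.
have hm : 2 * h < Num.min d1' d2'.
  have q (m : R) : 0 < m -> 2 * (m / 4) < m by clear; move=> m0; lra.
  exact: q.
have h1 : 2 * h < d1'.
  by apply: (lt_le_trans hm); rewrite ge_min lexx.
have h2 : 2 * h < d2'.
  by apply: (lt_le_trans hm); rewrite ge_min lexx orbT.
have [y [yx Ey]] := @second_difference phi i j x h h0 d1 (fun y => d2 y i j).
have [z [zx Ez]] := @second_difference phi j i x h h0 d1 (fun y => d2 y j i).
have AB : A z = B y.
  have hh : h * h != 0 by rewrite mulf_neq0 ?gt_eqF.
  apply: (mulfI hh); rewrite -[RHS]Ey -[LHS]Ez [x + _ + _]addrAC; ring.
have := hA z; rewrite /ball_ /mkset distrC => /(_ (le_lt_trans zx h1)) hz.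
have := hB y; rewrite /ball_ /mkset distrC => /(_ (le_lt_trans yx h2)) hy.
have mid (a b c : R) : `|a - c| < `|a - b| / 2 -> `|b - c| < `|a - b| / 2 ->
    False.
  move=> ac bc; have := ler_distD c a b; rewrite leNgt => /negP; apply.
  by rewrite [ltRHS]splitr ltrD// distrC.
by apply: (mid (A x) (B x) (A z) hz); rewrite AB; exact: hy.
Qed.

End schwarz.

(** * Iterated derivatives and linear combinations of test functions *)

Section test_functions.
Context {R : realType} {n : nat}.
Implicit Types (phi psi : 'rV[R]_n -> R) (i j : 'I_n) (w : seq 'I_n).

Lemma partials_cat w1 w2 phi :
  partials (w1 ++ w2) phi = partials w1 (partials w2 phi).
Proof. exact: foldr_cat. Qed.

Lemma smooth_partials w phi : smooth phi -> smooth (partials w phi).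
Proof. by move=> sphi w'; rewrite -partials_cat; exact: sphi. Qed.

Lemma partials_comm i j phi : smooth phi ->
  'D_('e_i) ('D_('e_j) phi) = 'D_('e_j) ('D_('e_i) phi).
Proof.
move=> sphi; apply/funext => x; apply: derive_comm.
- by move=> y k; exact: (sphi [::]).2.
- by move=> y k l; exact: (sphi [:: k]).2.
- exact: (sphi [:: i; j]).1.
- exact: (sphi [:: j; i]).1.
Qed.

Lemma partials_rcons w i phi : smooth phi ->
  partials (rcons w i) phi = 'D_('e_i) (partials w phi).
Proof.
move=> sphi; elim: w => [//|j w IH] /=.
by rewrite IH; exact: (partials_comm _ _ (smooth_partials w sphi)).
Qed.

(** [mi_deriv] differentiates in the order of the coordinates; this lets an extra derivative enter
    at any place, as [mi_deriv_succ] and [sobolev0_shift] require. *)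
Lemma perm_partials w1 w2 phi : smooth phi -> perm_eq w1 w2 ->
  partials w1 phi = partials w2 phi.
Proof.
move=> sphi; elim: w1 w2 => [|i w1 IH] w2 pw.
  by rewrite (perm_nilP (etrans (perm_sym _ _) pw)).
have iw2 : i \in w2 by rewrite -(perm_mem pw) mem_head.
case/splitPr: iw2 pw => s1 s2 pw; rewrite -cat_rcons partials_cat.
rewrite partials_rcons; last exact: smooth_partials.
rewrite -partials_cat /= (IH (s1 ++ s2))//.
by rewrite -(perm_cons i) (perm_trans pw)// perm_catC/= perm_cons perm_catC.
Qed.

Lemma count_multiindex (a : multiindex n) i :
  count_mem i (flatten [seq nseq (a j) j | j <- enum 'I_n]) = a i.
Proof.
rewrite count_flatten -map_comp sumnE big_map big_enum (bigD1 i)//=.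
rewrite count_nseq/= eqxx mul1n big1 ?addn0// => j ji.
by rewrite count_nseq/= (negbTE ji).
Qed.

Lemma mi_deriv_succ (a : multiindex n) i phi : smooth phi ->
  mi_deriv (mi_succ a i) phi = mi_deriv a ('D_('e_i) phi).
Proof.
move=> sphi; rewrite /mi_deriv -[RHS](partials_cat _ [:: i]).
apply: perm_partials => //; apply/allP => j _ /=.
by rewrite count_cat !count_multiindex ffunE/= addn0 (eq_sym i).
Qed.

Lemma mi_deriv0 phi : mi_deriv mi0 phi = phi.
Proof.
rewrite /mi_deriv (_ : flatten _ = [::])//; apply/size0nil.
rewrite size_flatten sumnE !big_map big1 // => j _.
by rewrite size_nseq ffunE.
Qed.

Lemma partials_lin w (c : R) phi psi : smooth phi -> smooth psi ->
  partials w (fun x => c * phi x + psi x) =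
  fun x => c * partials w phi x + partials w psi x.
Proof.
move=> sphi spsi; elim: w => [//|i w IH] /=; rewrite IH; apply/funext => x.
have d1 := (sphi w).2 x i; have d2 := (spsi w).2 x i.
have d3 : derivable (c \*: partials w phi) x 'e_i by exact: derivableZ.
rewrite (deriveD d3 d2); congr (_ + _).
exact: deriveZ.
Qed.

Lemma smooth_lin (c : R) phi psi : smooth phi -> smooth psi ->
  smooth (fun x => c * phi x + psi x).
Proof.
move=> sphi spsi w; rewrite partials_lin//.
rewrite -[X in continuous X]/((c \*: partials w phi) \+ partials w psi).
rewrite -[X in derivable X]/((c \*: partials w phi) \+ partials w psi).
split=> [x|x i].
  apply: continuousD; last exact: (spsi w).1.
  by apply: continuousZr; exact: (sphi w).1.
apply: derivableD; last exact: (spsi w).2.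
by apply: derivableZ; exact: (sphi w).2.
Qed.

Lemma test_function_lin Omega (c : R) phi psi :
  test_function Omega phi -> test_function Omega psi ->
  test_function Omega (fun x => c * phi x + psi x).
Proof.
move=> [s1 c1 o1] [s2 c2 o2].
have sub : closure [set x | c * phi x + psi x != 0] `<=`
    closure [set x | phi x != 0] `|` closure [set x | psi x != 0].
  rewrite -closureU; apply: closureS => x /= h.
  have [p0|] := eqVneq (phi x) 0; [right|by left].
  by apply: contra h => /eqP ->; rewrite p0 mulr0 addr0.
split; first exact: smooth_lin.
- apply: subclosed_compact sub; first exact: closed_closure.
  exact: compactU.
- by move=> x /sub [/o1|/o2].
Qed.

Lemma derive_eq0 phi (v x : 'rV[R]_n) : (\near x, phi x = 0) -> 'D_v phi x = 0.
Proof.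
move=> p0; rewrite -[RHS](derive_cst 0 x v).
by apply: near_eq_derive.
Qed.

(** Off its closed support phi vanishes on a whole neighbourhood, so its derivative vanishes there
    and the support does not grow. *)
Lemma test_function_derive Omega i phi :
  test_function Omega phi -> test_function Omega ('D_('e_i) phi).
Proof.
move=> [s1 c1 o1].
have sub : closure [set x | 'D_('e_i) phi x != 0] `<=`
    closure [set x | phi x != 0].
  move/closure_id: (@closed_closure _ [set x | phi x != 0]) => ->.
  apply: closureS => x /= h; apply: contrapT => nx.
  have : nbhs x (~` closure [set x | phi x != 0]).
    by apply: open_nbhs_nbhs; split => //; exact/closed_openC/closed_closure.
  move=> nb; move/negP: h; apply; apply/eqP; apply: derive_eq0.
  apply: filterS nb => y /= ny; apply/eqP/negPn/negP => py; apply: ny.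
  exact: subset_closure.
split; first exact: (smooth_partials [:: i]).
- by apply: subclosed_compact sub => //; exact: closed_closure.
- exact: subset_trans sub o1.
Qed.

Lemma test_function_mi_deriv Omega (a : multiindex n) phi :
  test_function Omega phi -> test_function Omega (mi_deriv a phi).
Proof.
rewrite /mi_deriv => tphi; elim: (flatten _) => [//|i w IH] /=.
exact: test_function_derive.
Qed.

Lemma test_function0 (Omega : set 'rV[R]_n) : test_function Omega (cst 0).
Proof.
have E : [set x | (cst 0 : 'rV[R]_n -> R) x != 0] = set0.
  by apply/seteqP; split => x //=; rewrite eqxx.
split; rewrite ?E ?closure0//; last exact: compact0.
by apply: Ck_smooth => k; exact: Ck_cst.
Qed.

End test_functions.

(** * Bump functions on boxes *)

Section bump.
Context {R : realType} {n : nat}.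

Definition box (a b : 'I_n -> R) : set 'rV[R]_n :=
  [set x | forall i, a i < x 0 i < b i].

(** The arguments are written with factors [1 *] and [-1 *] to match the affine form in
    [Ck_flat]. *)
Definition bump (a b : 'I_n -> R) (x : 'rV[R]_n) : R :=
  \prod_i (flat 1 (1 * x 0 i + - a i) * flat 1 (-1 * x 0 i + b i)).

Lemma flat1_ge0 (t : R) : 0 <= flat 1 t.
Proof. by rewrite /flat; case: ifP => // _; rewrite hornerC mul1r expR_ge0. Qed.

Lemma flat1_gt0 (t : R) : (0 < flat 1 t) = (0 < t).
Proof.
rewrite /flat; case: ifP => [_|]; last by rewrite ltxx.
by rewrite hornerC mul1r expR_gt0.
Qed.

Lemma bump_ge0 a b x : 0 <= bump a b x.
Proof. by apply: prodr_ge0 => i _; rewrite mulr_ge0// flat1_ge0. Qed.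

Lemma bump_neq0 a b x : bump a b x != 0 <-> box a b x.
Proof.
have flat_neq0 (t : R) : (flat 1 t != 0) = (0 < t).
  by rewrite -flat1_gt0 lt_neqAle flat1_ge0 andbT eq_sym.
have E i : (a i < x 0 i < b i) =
    (flat 1 (1 * x 0 i + - a i) * flat 1 (-1 * x 0 i + b i) != 0).
  rewrite mulf_eq0 negb_or !flat_neq0 mul1r subr_gt0 mulN1r addrC subr_gt0.
  by [].
rewrite /bump /box/=; split => [/prodf_neq0 h i|h]; first by rewrite E h.
by apply/prodf_neq0 => i _; rewrite -E.
Qed.

Lemma test_function_bump (Omega : set 'rV[R]_n) a b :
  (forall x : 'rV[R]_n, (forall i, a i <= x 0 i <= b i) -> Omega x) ->
  test_function Omega (bump a b).
Proof.
move=> abO.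
pose K : set 'rV[R]_n := [set x | forall i, `[a i, b i]%classic (x 0 i)].
have cK : compact K.
  apply: (@rV_compact _ _ (fun i => `[a i, b i]%classic)) => i.
  exact: segment_compact.
have sub : closure [set x | bump a b x != 0] `<=` K.
  rewrite (_ : K = closure K); last first.
    by apply/closure_id; apply: (compact_closed (@norm_hausdorff _ _)).
  apply: closureS => x /bump_neq0 h i.
  by rewrite /= in_itv/=; have /andP[/ltW -> /ltW ->] := h i.
split.
- by apply: Ck_smooth => k; apply: Ck_prod => i; apply: CkM; exact: Ck_flat.
- by apply: subclosed_compact sub => //; exact: closed_closure.
- move=> x /sub h; apply: abO => i; have := h i.
  by rewrite /= in_itv.
Qed.

End bump.

(** * Lebesgue measure on R^n *)

Section leb_theory.
Context {R : realType}.

Lemma measurable_box n (a b : 'I_n -> R) : measurable (box a b).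
Proof.
have -> : box a b =
    \bigcap_i ((fun x : 'rV[R]_n => x 0 i) @^-1` `]a i, b i[).
  apply/seteqP; split => [x h i _|x h i]; first by rewrite /= in_itv/=.
  by have := h i I; rewrite /= in_itv.
apply: fin_bigcap_measurable => // i _; rewrite -[X in measurable X]setTI.
exact: measurable_rV_coord.
Qed.

(** The sigma-algebra is generated by the coordinates, so A is written as the union of the boxes
    with rational corners that it contains. Indexing by all pairs of corners, with the empty set for
    the boxes that stick out, keeps the union countable. *)
Lemma open_measurable_rV n (A : set 'rV[R]_n) : open A -> measurable A.
Proof.
move=> oA.
pose lo (q : {ffun 'I_n -> rat * rat}) i : R := ratr (q i).1.
pose hi (q : {ffun 'I_n -> rat * rat}) i : R := ratr (q i).2.
pose F q := if `[< box (lo q) (hi q) `<=` A >] then box (lo q) (hi q) else set0.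
have -> : A = \bigcup_q F q.
  apply/seteqP; split => [x Ax|x [q _]]; last first.
    by rewrite /F; case: ifP => [/asboolP h|_] //; exact: h.
  have /nbhs_ballP[e /= e0 xe] : nbhs x A by exact: open_nbhs_nbhs.
  pose P i (q : rat * rat) := [/\ x 0 i - e < ratr q.1 , ratr q.1 < x 0 i,
    x 0 i < ratr q.2 & ratr q.2 < x 0 i + e :> R].
  have exq i : exists q, P i q.
    have [l] := @rat_in_itvoo R (x 0 i - e) (x 0 i)
      (ltac:(by rewrite ltrBlDr ltrDl)).
    have [h] := @rat_in_itvoo R (x 0 i) (x 0 i + e) (ltac:(by rewrite ltrDl)).
    rewrite !in_itv/= => /andP[? ?] /andP[? ?].
    by exists (l, h).
  have [q qP] := choice exq.
  exists [ffun i => q i] => //; rewrite /F; case: asboolP => [_ i|[]].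
    by rewrite /lo /hi ffunE; have [_ -> ->] := qP i.
  move=> y yq; apply: xe; split => // i j; rewrite ord1.
  have := yq j; rewrite /lo /hi ffunE; have [h1 h2 h3 h4] := qP j.
  move=> /andP[h5 h6]; rewrite /ball/= ltr_norml.
  apply/andP; split; rewrite ?ltrBrDr ?ltrBlDr.
    by rewrite addrC ltrBlDr (lt_trans h6)// .
  by rewrite -ltrBlDl (lt_trans h1).
apply: countable_bigcupT_measurable => [|q]; first exact: countableP.
by rewrite /F; case: ifP => // _; exact: measurable_box.
Qed.

Lemma continuous_measurable_rV n (f : 'rV[R]_n -> R) :
  continuous f -> measurable_fun setT (f : _ -> measurableTypeR R).
Proof.
move=> cf; apply: (measurability _ (RGenOpens.measurableE R)).
move=> _ [_ [a [b ->] <-]]; rewrite setTI; apply: open_measurable_rV.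
by move/continuousP : cf; apply; exact: interval_open.
Qed.

Lemma leb_box n (a b : 'I_n -> R) : (forall i, a i < b i) ->
  leb R n (box a b) = (\prod_i (b i - a i))%:E.
Proof.
elim: n a b => [|n IH] a b ab.
  rewrite big_ord0 /= diracE (_ : _ \in _)//.
  by apply/mem_set => -[].
rewrite /= /pushforward.
pose a' i := a (lift ord0 i); pose b' i := b (lift ord0 i).
have -> : @rV_cons R n @^-1` box a b = `]a ord0, b ord0[%classic `*` box a' b'.
  apply/seteqP; split => -[t y] /=.
    move=> h; split; first by have := h ord0; rewrite mxE unlift_none/= in_itv.
    by move=> i; have := h (lift ord0 i); rewrite mxE liftK.
  move=> [/= tab h] i; rewrite mxE; case: unliftP => [j ->|->] /=.
    exact: h.
  by move: tab; rewrite in_itv.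
rewrite product_measure1E//; last exact: measurable_box.
rewrite big_ord_recl EFinM; congr (_ * _)%E; last by apply: IH => i; exact: ab.
by rewrite [LHS]lebesgue_measure_itv/= lte_fin ab.
Qed.

End leb_theory.

(** * Iterated integrals and the integral of a partial derivative *)

Section leb_integration.
Context {R : realType}.

Definition cube n (M : R) : set 'rV[R]_n := box (fun=> - M) (fun=> M).

Lemma integrable_continuous_cube n (f : 'rV[R]_n -> R) M : 0 < M ->
  continuous f -> (forall x, ~ cube M x -> f x = 0) ->
  (leb R n).-integrable setT (EFin \o f).
Proof.
move=> M0 cf f0; have mQ := @measurable_box R n (fun=> - M) (fun=> M).
have -> : EFin \o f = (EFin \o f) \_ (cube M).
  apply/funext => x; rewrite patchE; case: ifPn => // /negP xM /=.
  by rewrite f0// => h; apply: xM; exact/mem_set.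
apply/(integrable_mkcond _ mQ); apply: measurable_bounded_integrable => //.
- rewrite [X in (X < _)%E](leb_box (b := fun=> M)) ?ltry// => i.
  by rewrite gtrN.
- by apply: measurable_funTS; exact: continuous_measurable_rV.
- pose K : set 'rV[R]_n := [set x | forall i, `[- M, M]%classic (x 0 i)].
  have cK : compact K.
    apply: (@rV_compact _ _ (fun i => `[- M, M]%classic)) => i.
    exact: segment_compact.
  have /compact_bounded : compact (f @` K).
    by apply: continuous_compact => //; exact: continuous_subspaceT.
  move=> [C [Cr hC]]; exists C; split=> // y Cy x xM.
  apply: (hC y Cy (f x)); exists x => // i /=.
  by have /andP[/ltW h1 /ltW h2] := xM i; rewrite in_itv/= h1.
Qed.

Lemma integral_derive_line (g dg : R -> R) M : 0 < M ->
  (forall t : R, is_derive t (1 : R) g (dg t)) -> continuous dg ->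
  (forall t, M <= `|t| -> g t = 0) -> (forall t, M <= `|t| -> dg t = 0) ->
  (\int[lebesgue_measure]_t (dg t)%:E = 0)%E.
Proof.
move=> M0 dgE cdg g0 dg0.
have cg : continuous g.
  move=> t; apply/differentiable_continuous/derivable1_diffP.
  by have [] := dgE t.
have -> : (\int[lebesgue_measure]_t (dg t)%:E)%E =
    (\int[lebesgue_measure]_(t in `[(- M)%R, M]) (dg t)%:E)%E.
  rewrite [RHS]integral_mkcond; apply: eq_integral => t _.
  rewrite patchE; case: ifPn => // /negP tM; rewrite dg0// leNgt.
  apply/negP => h; apply: tM; apply/mem_set => /=; rewrite in_itv/=.
  by rewrite -ler_norml ltW.
rewrite (@continuous_FTC2 _ dg g)//.
- by rewrite !g0 ?subee// ?normrN ger0_norm// ltW.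
- by rewrite gtrN.
- exact: continuous_subspaceT.
- split; first by move=> t _; have [] := dgE t.
  + by apply: cvg_at_right_filter; exact: cg.
  + by apply: cvg_at_left_filter; exact: cg.
- by move=> t _; rewrite derive1E; have [_ ->] := dgE t.
Qed.

(** Change of variables along [rV_cons], of which the measure is a pushforward. Integrability on the
    product is returned as well because Fubini's theorem is applied to it. *)
Lemma integral_leb_succ n (f : 'rV[R]_n.+1 -> R) M : 0 < M ->
  continuous f -> (forall x, ~ cube M x -> f x = 0) ->
  ((lebesgue_measure \x leb R n)%E.-integrable setT
    (EFin \o (f \o @rV_cons R n)))
  /\ (\int[leb R n.+1]_x (f x)%:E =
     \int[lebesgue_measure \x leb R n]_p (f (@rV_cons R n p))%:E)%E.
Proof.
move=> M0 cf f0; have mc := @measurable_rV_cons R n.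
have mf := continuous_measurable_rV cf.
have mF : measurable_fun setT (EFin \o f) by exact/measurable_EFinP.
have intf := integrable_continuous_cube M0 cf f0.
have intF : (lebesgue_measure \x leb R n)%E.-integrable setT
    (EFin \o (f \o @rV_cons R n)).
  apply/integrableP; split.
    by apply/measurable_EFinP; exact: measurableT_comp.
  move/integrableP : intf => [_].
  rewrite /= [X in (X < _)%E](ge0_integral_pushforward mc)//.
  by apply/measurable_EFinP; exact: measurableT_comp.
split; first exact: intF.
pose m := (lebesgue_measure \x leb R n)%E.
transitivity (\int[pushforward m (@rV_cons R n)]_x (EFin \o f) x)%E.
  by [].
rewrite (@integral_pushforward _ _ _ _ R _ mc m setT _ mF intF measurableT).
by rewrite preimage_setT.
Qed.

Lemma rV_cons_line0 n (t : R) (y : 'rV[R]_n) :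
  rV_cons (t, y) = rV_cons (0, y) + t *: 'e_ord0.
Proof.
apply/rowP => k; rewrite !mxE; case: unliftP => [j ->|->] /=.
  by rewrite mulr0 addr0.
by rewrite mulr1 add0r.
Qed.

Lemma rV_cons_line_lift n (t h : R) (y : 'rV[R]_n) j :
  rV_cons (t, h *: 'e_j + y) = h *: 'e_(lift ord0 j) + rV_cons (t, y).
Proof.
apply/rowP => k; rewrite !mxE; case: unliftP => [l ->|->] /=.
  by rewrite !mxE (inj_eq lift_inj).
by rewrite mulr0 add0r.
Qed.

Lemma cube_rV_cons n M (t : R) (y : 'rV[R]_n) :
  cube M (rV_cons (t, y)) <-> - M < t < M /\ cube M y.
Proof.
split=> [h|[ht hy] i]; last first.
  rewrite mxE; case: unliftP => [j _|_] /=; [exact: hy|exact: ht].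
split; first by have := h ord0; rewrite mxE unlift_none.
by move=> i; have := h (lift ord0 i); rewrite mxE liftK.
Qed.

Lemma continuous_rV_cons n (t : R) :
  continuous (fun y : 'rV[R]_n => rV_cons (t, y)).
Proof.
move=> y A /nbhs_ballP[e /= e0 eA]; apply/nbhs_ballP; exists e => //=.
move=> y' [_ yy']; apply: eA; split => // i j; rewrite !mxE.
by case: unliftP => [l _|_] /=; [exact: yy'|exact: ballxx].
Qed.

(** Along the first coordinate, integrate over that line first and use the fundamental theorem of
    calculus; along any other, integrate over the slices with the first coordinate fixed and use
    induction. The hypotheses are chosen so that they pass to slices. *)
Lemma integral_derive0 n (i : 'I_n) (chi : 'rV[R]_n -> R) M : 0 < M ->
  (forall x, derivable chi x 'e_i) -> continuous ('D_('e_i) chi) ->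
  (forall x, ~ cube M x -> chi x = 0) ->
  (forall x, ~ cube M x -> 'D_('e_i) chi x = 0) ->
  (\int[leb R n]_x ('D_('e_i) chi x)%:E = 0)%E.
Proof.
move=> M0; elim: n i chi => [|n IH] i chi; first by case: i.
move=> dchi cD chi0 D0; have [intF ->] := integral_leb_succ M0 cD D0.
have cond (t : R) : M <= `|t| -> ~ (- M < t < M).
  by rewrite leNgt -ltr_norml => /negP.
case: (unliftP ord0 i) => [j ij|i0].
  rewrite -(integral12_prod_meas1 intF) /fubini_F /=.
  rewrite [X in X = _](_ : _ = \int[lebesgue_measure]_(t in [set: R]) 0)%E.
    by rewrite integral0.
  apply: eq_integral => t _.
  pose chit (y : 'rV[R]_n) := chi (rV_cons (t, y)).
  have E y : (fun h : R => h^-1 *: ((chit \o shift y) (h *: 'e_j) - chit y)) =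
     (fun h : R => h^-1 *: ((chi \o shift (rV_cons (t, y))) (h *: 'e_i)
       - chi (rV_cons (t, y)))).
    by apply/funext => h; rewrite /chit /= ij rV_cons_line_lift.
  have DE : 'D_('e_j) chit = fun y => 'D_('e_i) chi (rV_cons (t, y)).
    by apply/funext => y; rewrite /derive E.
  transitivity (\int[leb R n]_y ('D_('e_j) chit y)%:E)%E.
    by apply: eq_integral => y _; exact: (congr1 (fun f => (f y)%:E) (esym DE)).
  apply: IH.
  - by move=> y; rewrite /derivable E; exact: dchi.
  - rewrite DE => y; apply: (@continuous_comp 'rV[R]_n 'rV[R]_n.+1 R
      (fun y => rV_cons (t, y)) ('D_('e_i) chi)).
      exact: continuous_rV_cons.
    exact: cD.
  - by move=> y ny; apply: chi0 => /cube_rV_cons[].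
  - by move=> y ny; rewrite [LHS](congr1 (@^~ y) DE) D0// => /cube_rV_cons[].
rewrite -(integral21_prod_meas1 intF) /fubini_G /=.
rewrite [X in X = _](_ : _ = \int[leb R n]_(y in [set: 'rV[R]_n]) 0)%E.
  by rewrite integral0.
apply: eq_integral => y _; rewrite i0 in dchi cD D0 *.
pose chiy (t : R) := chi (rV_cons (0, y) + t *: 'e_ord0).
pose dchiy (t : R) := 'D_('e_ord0) chi (rV_cons (0, y) + t *: 'e_ord0).
transitivity (\int[lebesgue_measure]_t (dchiy t)%:E)%E.
  by apply: eq_integral => t _; rewrite rV_cons_line0.
apply: (@integral_derive_line chiy dchiy M) => //.
- by move=> t; apply: is_derive_line; exact: dchi.
- move=> t; apply: (@continuous_comp R 'rV[R]_n.+1 R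
    (fun t : R => rV_cons (0, y) + t *: 'e_ord0) ('D_('e_ord0) chi));
    last exact: cD.
  apply: (@continuousD _ _ _ (cst _) (fun t : R => t *: 'e_ord0)).
    exact: cst_continuous.
  exact: scalel_continuous.
- move=> t tM; apply: chi0; rewrite -rV_cons_line0 => /cube_rV_cons[].
  by move/(cond _ tM).
- move=> t tM; apply: D0; rewrite -rV_cons_line0 => /cube_rV_cons[].
  by move/(cond _ tM).
Qed.

End leb_integration.

(** * Square-integrable functions *)

Section L2_theory.
Context {R : realType} {n : nat} (Omega : set 'rV[R]_n).
Implicit Types (f g h : 'rV[R]_n -> R) (c : R).

Local Notation mu := (leb R n).
Local Notation L2 := (L2 Omega).
Local Notation L2norm := (L2norm Omega).

Definition L2inner f g : R := \int[mu]_(x in Omega) (f x * g x).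

Let le12 : (1 <= 2%:E :> \bar R)%E. Proof. by rewrite lee_fin ler1n. Qed.

Let patch_lin c f g :
  (fun x => c * f x + g x) \_ Omega = c *: (f \_ Omega) + (g \_ Omega).
Proof.
apply/funext => x; rewrite /GRing.scale/= /Algebra.add/= !patchE.
by case: ifP => // _; apply/esym; exact: (etrans (addr0 _) (mulr0 _)).
Qed.

Let patch_mul f g : (fun x => f x * g x) \_ Omega = f \_ Omega \* g \_ Omega.
Proof.
by apply/funext => x; rewrite /= !patchE; case: ifP => // _; exact/esym/mulr0.
Qed.

Lemma L2_lin c f g : L2 f -> L2 g -> L2 (fun x => c * f x + g x).
Proof.
by rewrite /Defs.L2 patch_lin => h1 h2; exact: (Lfun_submod_closed mu le12).2.
Qed.

Lemma L2_0 : L2 (fun=> 0).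
Proof.
rewrite /Defs.L2 (_ : _ \_ _ = 0); first exact: (Lfun_submod_closed mu le12).1.
by apply/funext => x; rewrite patchE; case: ifP.
Qed.

Lemma L2_measurable f : L2 f -> measurable_fun setT (f \_ Omega).
Proof. by rewrite /Defs.L2 inE => /andP[/[!inE]]. Qed.

Lemma L2_finite f : L2 f -> ('N[mu]_2%:E [EFin \o (f \_ Omega)] < +oo)%E.
Proof. by rewrite /Defs.L2 inE => /andP[_ /[!inE]]. Qed.

Lemma L2norm_fineK f : L2 f ->
  (L2norm f)%:E = 'N[mu]_2%:E [EFin \o (f \_ Omega)]%E.
Proof. by move=> /L2_finite h; rewrite fineK// ge0_fin_numE// Lnorm_ge0. Qed.

Lemma L2norm_ge0 f : 0 <= L2norm f.
Proof. by rewrite fine_ge0// Lnorm_ge0. Qed.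

Lemma integrable_L2M f g : L2 f -> L2 g ->
  mu.-integrable setT (EFin \o ((fun x => f x * g x) \_ Omega)).
Proof.
move=> hf hg; apply/Lfun1_integrable.
by rewrite patch_mul; exact: Lfun2_mul_Lfun1.
Qed.

Lemma L2innerC f g : L2inner f g = L2inner g f.
Proof. by apply: eq_Rintegral => x _; rewrite mulrC. Qed.

Lemma L2inner_linl c f g h : L2 f -> L2 g -> L2 h ->
  L2inner (fun x => c * f x + g x) h = c * L2inner f h + L2inner g h.
Proof.
move=> hf hg hh; rewrite /L2inner !(Rintegral_mkcond mu Omega).
rewrite -RintegralZl//; last exact: integrable_L2M.
rewrite -RintegralD//; last 2 first.
- have := integrableZl measurableT c (integrable_L2M hf hh).
  by apply: eq_integrable => // x _ /=.
- exact: integrable_L2M.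
apply: eq_Rintegral => x _; rewrite !patchE; case: ifP => _.
  by rewrite mulrDl mulrA.
by rewrite mulr0 addr0.
Qed.

Lemma L2norm_sqr f : L2 f -> L2norm f ^+ 2 = L2inner f f.
Proof.
move=> hf; apply: EFin_inj; rewrite -powR_mulrn ?L2norm_ge0//.
rewrite -poweR_EFin L2norm_fineK// powR_Lnorm ?pnatr_eq0//.
rewrite /L2inner Rintegral_mkcond /Rintegral fineK; last first.
  exact/(integrable_fin_num measurableT)/integrable_L2M.
apply: eq_integral => x _; rewrite patch_mul /= powR_mulrn//.
by rewrite real_normK ?num_real.
Qed.

Lemma L2inner_le f g : L2 f -> L2 g -> `|L2inner f g| <= L2norm f * L2norm g.
Proof.
move=> hf hg; rewrite -lee_fin EFinM !L2norm_fineK//.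
rewrite /L2inner Rintegral_mkcond patch_mul.
have := @hoelder _ _ _ mu _ _ 2 2 (L2_measurable hf) (L2_measurable hg)
  (ltac:(by [])) (ltac:(by [])) (ltac:(by rewrite [RHS]splitr !div1r)).
apply: le_trans; rewrite Lnorm1.
rewrite EFin_normr_Rintegral//; last first.
  by rewrite -patch_mul; exact: integrable_L2M.
apply: le_abse_integral => //.
by apply/measurable_EFinP/measurable_funM; exact: L2_measurable.
Qed.

(** Expand the square of the left side as an inner product; Cauchy-Schwarz bounds the cross term. *)
Lemma L2norm_lin_le c f g : L2 f -> L2 g ->
  L2norm (fun x => c * f x + g x) <= `|c| * L2norm f + L2norm g.
Proof.
move=> hf hg; have hfg := L2_lin c hf hg.
rewrite -(@ler_pXn2r _ 2)// ?nnegrE ?L2norm_ge0 ?addr_ge0 ?mulr_ge0 ?L2norm_ge0//.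
have lr k : L2 k ->
    L2inner k (fun x => c * f x + g x) = c * L2inner k f + L2inner k g.
  by move=> hk; rewrite L2innerC L2inner_linl// !(L2innerC _ k).
rewrite L2norm_sqr// L2inner_linl// !lr// (L2innerC g f) -!L2norm_sqr//.
have fg : c * L2inner f g <= `|c| * (L2norm f * L2norm g).
  by rewrite (le_trans (ler_norm _))// normrM ler_wpM2l// L2inner_le.
have c2 : c * c = `|c| * `|c| by rewrite -!expr2 real_normK ?num_real.
rewrite mulrDr mulrA c2; move: fg {c2 lr hfg}.
set a := L2norm f; set b := L2norm g.
set i := L2inner f g; set d := `|c|; move: a b i d => a b i d fg; nra.
Qed.

Lemma L2norm_ae0 f : L2 f -> {ae mu, forall x, Omega x -> f x = 0} ->
  L2norm f = 0.
Proof.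
move=> hf f0; apply/eqP; rewrite -sqrf_eq0 L2norm_sqr//.
rewrite /L2inner Rintegral_mkcond /Rintegral.
rewrite (@ae_eq_integral _ _ _ mu setT (cst 0)%E)//.
- by rewrite integral0.
- exact: (measurable_int mu (integrable_L2M hf hf)).
apply: filterS f0 => x f0 _; rewrite patchE; case: ifPn => // /set_mem /f0 ->.
by rewrite mulr0.
Qed.

Lemma L2norm_0 : L2norm (fun=> 0) = 0.
Proof. by apply: (L2norm_ae0 L2_0); exact: aeW. Qed.

Lemma L2norm_eq0_ae f : L2 f -> L2norm f = 0 ->
  {ae mu, forall x, Omega x -> f x = 0}.
Proof.
move=> hf f0.
have mf : measurable_fun setT (EFin \o (f \_ Omega)).
  by apply/measurable_EFinP; exact: L2_measurable.
have p2 : (0 < 2%:E :> \bar R)%E by rewrite lte_fin.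
have := L2norm_fineK hf; rewrite f0 => /esym/(Lnorm_eq0_eq0 mf p2); apply: filterS.
by move=> x /(_ I) [] + Ox; rewrite patchE mem_set.
Qed.

End L2_theory.

(** * Integration by parts for test functions *)

Section test_integration.
Context {R : realType} {n : nat} (Omega : set 'rV[R]_n).
Implicit Types (phi psi : 'rV[R]_n -> R) (i : 'I_n).

Lemma test_function_cube phi : test_function Omega phi ->
  exists M, 0 < M /\ forall x, ~ cube M x -> phi x = 0.
Proof.
move=> [_ /compact_bounded [M [_ hM]] _]; exists (`|M| + 2); split.
  by rewrite ltr_wpDl.
move=> x nx; apply/eqP/negPn/negP => px; apply: nx => i.
have MM : M < `|M| + 1 by rewrite (le_lt_trans (ler_norm _))// ltrDl.
have := hM _ MM x (@subset_closure _ [set y | phi y != 0] x px).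
rewrite /= [leLHS]mx_normrE => h.
have xi : `|x 0 i| <= `|M| + 1.
  by apply: le_trans h; apply: (le_bigmax _ (fun ij => `|x ij.1 ij.2|) (0, i)).
by rewrite -ltr_norml (le_lt_trans xi)// ltrD2l ltr1n.
Qed.

Lemma cube_le (M N : R) : M <= N -> cube M `<=` @cube R n N.
Proof.
move=> MN x h i; have /andP[h1 h2] := h i.
by rewrite (le_lt_trans _ h1) ?lerN2// (lt_le_trans h2).
Qed.

Lemma test_function_continuous phi : test_function Omega phi -> continuous phi.
Proof. by move=> [s _ _]; exact: (s [::]).1. Qed.

Lemma test_function_out phi x : test_function Omega phi -> ~ Omega x -> phi x = 0.
Proof.
move=> [_ _ sub] nx; apply/eqP/negPn/negP => px; apply/nx/sub.
exact: subset_closure.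
Qed.

Lemma test_function_L2 phi : test_function Omega phi -> L2 Omega phi.
Proof.
move=> tphi; have [M [M0 phi0]] := test_function_cube tphi.
have cphi := test_function_continuous tphi.
have E : phi \_ Omega = phi.
  apply/funext => x; rewrite patchE; case: ifPn => // /negP nx.
  by rewrite (test_function_out tphi)// => Ox; apply/nx/mem_set.
have mphi := continuous_measurable_rV cphi.
rewrite /L2 E inE; apply/andP; split; rewrite inE//=.
rewrite /finite_norm unlock /=; apply: poweR_lty.
have cphi2 : continuous (phi \* phi) by move=> x; apply: continuousM; exact: cphi.
have /(integrable_continuous_cube M0 cphi2)/integrableP[_] :
    forall x, ~ cube M x -> (phi \* phi) x = 0.
  by move=> x /phi0 /= ->; rewrite mulr0.
apply: le_lt_trans; rewrite le_eqVlt; apply/orP; left; apply/eqP.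
apply: eq_integral => x _ /=; rewrite powR_mulrn// -expr2 normrX.
by [].
Qed.

Lemma L2inner_by_parts i phi psi :
  test_function Omega phi -> test_function Omega psi ->
  L2inner Omega ('D_('e_i) phi) psi = - L2inner Omega phi ('D_('e_i) psi).
Proof.
move=> tphi tpsi; apply/eqP; rewrite -addr_eq0; apply/eqP.
have tDphi := test_function_derive i tphi.
have tDpsi := test_function_derive i tpsi.
have [M1 [M10 z1]] := test_function_cube tphi.
have [M2 [M20 z2]] := test_function_cube tDphi.
(* Each term of the product rule contains phi or its derivative, so one cube outside which both
   vanish serves for the product and its derivative. *)
pose M := Num.max M1 M2.
have M0 : 0 < M by rewrite lt_max M10.
have z x : ~ cube M x -> phi x = 0 /\ 'D_('e_i) phi x = 0.
  by move=> nx; split; [apply: z1|apply: z2]; apply: contra_not nx;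
    apply: cube_le; rewrite le_max lexx ?orbT.
have d1 x : derivable phi x 'e_i by case: tphi => s _ _; exact: (s [::]).2.
have d2 x : derivable psi x 'e_i by case: tpsi => s _ _; exact: (s [::]).2.
have DM : 'D_('e_i) (phi \* psi) =
    (phi \* 'D_('e_i) psi) \+ (psi \* 'D_('e_i) phi).
  by apply/funext => x; exact: deriveM.
have cD : continuous ('D_('e_i) (phi \* psi)).
  rewrite DM => x; apply: continuousD; apply: continuousM;
  exact: test_function_continuous.
have := @integral_derive0 R n i (phi \* psi) M M0 _ cD _ _.
have L1 := test_function_L2 tphi; have L2' := test_function_L2 tpsi.
have L3 := test_function_L2 tDphi; have L4 := test_function_L2 tDpsi.
rewrite /L2inner !(Rintegral_mkcond (leb R n) Omega) -RintegralD//; last 2 first.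
- exact: integrable_L2M.
- exact: integrable_L2M.
rewrite /Rintegral => I0; rewrite -[RHS]/(fine 0%E) -I0; first last.
- move=> x /z[h1 h2]; rewrite [LHS](congr1 (@^~ x) DM) /= h1 h2.
  by rewrite mul0r mulr0 addr0.
- by move=> x /z[h1 h2]; rewrite /= h1 mul0r.
- by move=> x; exact: derivableM.
congr fine; apply: eq_integral => x _; rewrite [X in _ = X%:E](congr1 (@^~ x) DM).
rewrite !patchE /=; case: ifPn => [_|/negP nx].
  by rewrite addrC [psi x * _]mulrC.
have nO : ~ Omega x by move=> Ox; apply/nx/mem_set.
by rewrite (test_function_out tphi nO) (test_function_out tpsi nO) !mul0r.
Qed.

End test_integration.

(** * Sobolev jets *)

Section multiindices.
Context {n : nat}.
Implicit Types (a : multiindex n) (i : 'I_n).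

Lemma mi_order_succ a i : mi_order (mi_succ a i) = (mi_order a).+1.
Proof.
rewrite /mi_order; under eq_bigr do rewrite ffunE.
rewrite big_split/= -addn1; congr addn.
by rewrite (bigD1 i)//= eqxx big1// => j /negbTE ->.
Qed.

Lemma mi_order0 : mi_order (@mi0 n) = 0%N.
Proof. by rewrite /mi_order big1// => i _; rewrite ffunE. Qed.

Lemma mi_order_eq0 a : mi_order a = 0%N -> a = mi0.
Proof.
move=> /eqP; rewrite sum_nat_eq0 => /forallP a0.
by apply/ffunP => i; rewrite ffunE; exact/eqP/(implyP (a0 i)).
Qed.

Lemma mi_order_gt0 a k : mi_order a = k.+1 ->
  exists b i, a = mi_succ b i /\ mi_order b = k.
Proof.
move=> ak; have [i ai] : exists i, a i != 0%N.
  apply: contrapT => h; suff : mi_order a = 0%N by rewrite ak.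
  rewrite /mi_order big1// => i _; apply/eqP/negPn/negP => ai.
  by apply: h; exists i.
pose b : multiindex n := [ffun j => (a j - (j == i))%N].
have E : a = mi_succ b i.
  apply/ffunP => j; rewrite !ffunE; case: eqP => [->|_].
    by rewrite subnK// lt0n.
  by rewrite subn0 addn0.
by exists b, i; split => //; move: ak; rewrite {1}E mi_order_succ => -[].
Qed.

Lemma mi_order_le1 a : (mi_order a <= 1)%N ->
  a = mi0 \/ exists i, a = mi_succ mi0 i.
Proof.
rewrite leq_eqVlt => /orP[/eqP /mi_order_gt0 [b [i [-> /mi_order_eq0 ->]]]|].
  by right; exists i.
by rewrite ltnS leqn0 => /eqP/mi_order_eq0; left.
Qed.

End multiindices.

Section sobolev_theory.
Context {R : realType} {n : nat} (Omega : set 'rV[R]_n).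
Implicit Types (u v z : jet R n) (phi psi : 'rV[R]_n -> R) (i : 'I_n) (s : nat).

Local Notation L2norm := (L2norm Omega).
Local Notation seminorm := (seminorm Omega).
Local Notation sobolev_norm := (sobolev_norm Omega).
Local Notation sobolev0 := (sobolev0 Omega).

Lemma seminorm_ge0 s u : 0 <= seminorm s u. Proof. exact: sqrtr_ge0. Qed.

Lemma sobolev_norm_ge0 s u : 0 <= sobolev_norm s u. Proof. exact: sqrtr_ge0. Qed.

Lemma sqr_seminorm s u : seminorm s u ^+ 2 =
  \sum_(a : {ffun 'I_n -> 'I_s.+1} | (\sum_(i < n) a i)%N == s)
    L2norm (u [ffun i => a i : nat]) ^+ 2.
Proof. by rewrite sqr_sqrtr// sumr_ge0// => a _; exact: sqr_ge0. Qed.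

Lemma L2norm_le_seminorm u (a : multiindex n) :
  L2norm (u a) <= seminorm (mi_order a) u.
Proof.
rewrite -(@ler_pXn2r _ 2)// ?nnegrE ?L2norm_ge0 ?seminorm_ge0// sqr_seminorm.
pose b : {ffun 'I_n -> 'I_(mi_order a).+1} := [ffun i => inord (a i)].
have bE i : (b i : nat) = a i.
  by rewrite ffunE inordK// ltnS /mi_order (bigD1 i)//= leq_addr.
rewrite (bigD1 b)/=; last by apply/eqP; apply: eq_bigr => i _.
rewrite (_ : [ffun i => b i : nat] = a); last first.
  by apply/ffunP => i; rewrite ffunE bE.
by rewrite lerDl sumr_ge0// => ? _; exact: sqr_ge0.
Qed.

Lemma seminorm_le_sobolev_norm k s u : (k <= s)%N ->
  seminorm k u <= sobolev_norm s u.
Proof.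
move=> ks; rewrite -(@ler_pXn2r _ 2)// ?nnegrE ?sobolev_norm_ge0 ?seminorm_ge0//.
rewrite [leRHS]sqr_sqrtr; last by rewrite sumr_ge0// => ? _; exact: sqr_ge0.
rewrite (bigD1 (Ordinal (ks : (k < s.+1)%N)))//=.
by rewrite lerDl sumr_ge0// => ? _; exact: sqr_ge0.
Qed.

Lemma L2norm_le_sobolev_norm s u (a : multiindex n) : (mi_order a <= s)%N ->
  L2norm (u a) <= sobolev_norm s u.
Proof.
by move=> h; apply: le_trans (seminorm_le_sobolev_norm u h);
  exact: L2norm_le_seminorm.
Qed.

(** K is the square root of the number of multi-indices of order s. Together with
    [L2norm_le_seminorm] it trades the norms for bounds on single components. *)
Lemma seminorm_le s : exists K, 0 <= K /\ forall u e, 0 <= e ->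
  (forall a : multiindex n, mi_order a = s -> L2norm (u a) <= e) ->
  seminorm s u <= K * e.
Proof.
exists (Num.sqrt
  (\sum_(a : {ffun 'I_n -> 'I_s.+1} | (\sum_(i < n) a i)%N == s) 1)).
split=> [|u e e0 ue]; first exact: sqrtr_ge0.
rewrite -[X in _ * X]ger0_norm// -sqrtr_sqr -sqrtrM; last by rewrite sumr_ge0.
apply: ler_wsqrtr; rewrite mulr_suml ler_sum// => a /eqP aE; rewrite mul1r.
rewrite ler_pXn2r ?nnegrE ?L2norm_ge0//; apply: ue.
by rewrite /mi_order; under eq_bigr do rewrite ffunE.
Qed.

Lemma sobolev_norm_le s : exists K, 0 <= K /\ forall u e, 0 <= e ->
  (forall a : multiindex n, (mi_order a <= s)%N -> L2norm (u a) <= e) ->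
  sobolev_norm s u <= K * e.
Proof.
have /choice [K KP] := seminorm_le.
exists (Num.sqrt (\sum_(k < s.+1) K k ^+ 2)).
split=> [|u e e0 ue]; first exact: sqrtr_ge0.
have K20 : 0 <= \sum_(k < s.+1) K k ^+ 2.
  by rewrite sumr_ge0// => ? _; exact: sqr_ge0.
rewrite -[X in _ * X]ger0_norm// -sqrtr_sqr -sqrtrM//.
apply: ler_wsqrtr; rewrite mulr_suml ler_sum// => k _.
have [Kk0 Kk] := KP k; rewrite -exprMn.
rewrite ler_pXn2r ?nnegrE ?seminorm_ge0 ?mulr_ge0//.
by apply: Kk => // a ak; apply: ue; rewrite ak -ltnS.
Qed.

(** With the approximation stated component by component, closure under linear combinations and
    derivatives reduces to facts about L^2. *)
Lemma sobolev0P s u : sobolev0 s u <-> sobolev Omega s u /\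
  forall e, 0 < e -> exists2 phi, test_function Omega phi &
    forall a : multiindex n, (mi_order a <= s)%N ->
      L2norm (fun x => u a x - mi_deriv a phi x) < e.
Proof.
split=> -[su h]; split => // e e0.
  have [phi tphi hphi] := h e e0; exists phi => // a sa.
  exact: (le_lt_trans (@L2norm_le_sobolev_norm s
    (fun a x => u a x - jet_of phi a x) a sa)).
have [K [K0 hK]] := sobolev_norm_le s.
have e'0 : 0 < e / (K + 1) by rewrite divr_gt0// ltr_wpDl.
have [phi tphi hphi] := h _ e'0; exists phi => //.
apply: (le_lt_trans (hK _ _ (ltW e'0) (fun a sa => ltW (hphi a sa)))).
by rewrite mulrA ltr_pdivrMr ?ltr_wpDl// mulrC ltr_pM2l// ltrDl.
Qed.

Lemma sobolev0_le s t u : (s <= t)%N -> sobolev0 t u -> sobolev0 s u.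
Proof.
move=> st /sobolev0P[su h]; apply/sobolev0P; split.
  by move=> a sa; apply: su; exact: leq_trans st.
move=> e /h[phi tphi hphi]; exists phi => // a sa.
by apply: hphi; exact: leq_trans st.
Qed.

Lemma sobolev0_L2 s u (a : multiindex n) :
  sobolev0 s u -> (mi_order a <= s)%N -> L2 Omega (u a).
Proof. by move=> [su _] /su[]. Qed.

Lemma test_mi_deriv_L2 phi (a : multiindex n) : test_function Omega phi ->
  L2 Omega (mi_deriv a phi).
Proof. by move=> /(test_function_mi_deriv a)/test_function_L2. Qed.

Lemma weak_derivativeP (a : multiindex n) (f g : 'rV[R]_n -> R) :
  weak_derivative Omega a f g <-> forall psi, test_function Omega psi ->
    L2inner Omega f (mi_deriv a psi) = (-1) ^+ mi_order a * L2inner Omega g psi.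
Proof. by []. Qed.

Lemma mi_deriv_lin (a : multiindex n) c phi psi : smooth phi -> smooth psi ->
  mi_deriv a (fun x => c * phi x + psi x) =
  fun x => c * mi_deriv a phi x + mi_deriv a psi x.
Proof. exact: partials_lin. Qed.

Lemma sobolev0_lin s (c : R) u v : sobolev0 s u -> sobolev0 s v ->
  sobolev0 s (fun a x => c * u a x + v a x).
Proof.
move=> /sobolev0P[su hu] /sobolev0P[sv hv]; apply/sobolev0P; split.
  move=> a sa; have [Lu wu] := su a sa; have [Lv wv] := sv a sa.
  have [Lu0 _] := su mi0 (ltac:(by rewrite mi_order0)).
  have [Lv0 _] := sv mi0 (ltac:(by rewrite mi_order0)).
  split; first exact: L2_lin.
  apply/weak_derivativeP => psi tpsi.
  have Lp := test_function_L2 tpsi; have Lap := test_mi_deriv_L2 a tpsi.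
  rewrite !L2inner_linl//.
  move/weak_derivativeP : wu => ->//; move/weak_derivativeP : wv => ->//.
  by rewrite mulrDr mulrCA.
move=> e e0.
have e1 : 0 < e / 2 / (`|c| + 1) by rewrite !divr_gt0// ltr_wpDl.
have [phi tphi hphi] := hu _ e1.
have [psi tpsi hpsi] := hv (e / 2) (ltac:(by rewrite divr_gt0)).
exists (fun x => c * phi x + psi x); first exact: test_function_lin.
move=> a sa; have [Lu _] := su a sa; have [Lv _] := sv a sa.
have L1 : L2 Omega (fun x => u a x - mi_deriv a phi x).
  rewrite (_ : (fun x => _) = fun x => (-1) * mi_deriv a phi x + u a x).
    by apply: L2_lin => //; exact: test_mi_deriv_L2.
  by apply/funext => x; rewrite mulN1r addrC.
have L2' : L2 Omega (fun x => v a x - mi_deriv a psi x).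
  rewrite (_ : (fun x => _) = fun x => (-1) * mi_deriv a psi x + v a x).
    by apply: L2_lin => //; exact: test_mi_deriv_L2.
  by apply/funext => x; rewrite mulN1r addrC.
rewrite mi_deriv_lin; [|by case: tphi|by case: tpsi].
rewrite (_ : (fun x => _) = fun x => c * (u a x - mi_deriv a phi x) +
  (v a x - mi_deriv a psi x)); last by apply/funext => x; ring.
apply: (le_lt_trans (L2norm_lin_le c L1 L2')).
rewrite [ltRHS]splitr ler_ltD ?hpsi//.
apply: (@le_trans _ _ ((`|c| + 1) * (e / 2 / (`|c| + 1)))).
  by rewrite ler_pM ?L2norm_ge0 ?lerDl// ltW// hphi.
by rewrite mulrC divfK// gt_eqF// ltr_wpDl.
Qed.

Lemma sobolev0_0 s : sobolev0 s (fun _ _ => 0).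
Proof.
apply/sobolev0P; split=> [a sa|e e0].
  split; first exact: L2_0.
  move=> psi tpsi.
  have E g : \int[leb R n]_(x in Omega) (0 * g x) =
      \int[leb R n]_(x in Omega) (0 : R).
    by apply: eq_Rintegral => x _; rewrite mul0r.
  rewrite !E.
  have -> : \int[leb R n]_(x in Omega) (0 : R) = 0.
    by rewrite /Rintegral integral0_eq.
  by rewrite mulr0.
exists (cst 0); first exact: test_function0.
move=> a sa.
have Ds : forall w, partials w (cst 0 : 'rV[R]_n -> R) = cst 0.
  elim=> [//|i w /= ->]; apply/funext => x; exact: derive_cst.
have -> : (fun x => 0 - mi_deriv a (cst 0 : 'rV[R]_n -> R) x) = fun=> 0.
  by apply/funext => x; rewrite /mi_deriv Ds subr0.
by rewrite L2norm_0.
Qed.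

Lemma sobolev0_sum s I (r : seq I) (F : I -> jet R n) :
  (forall j, sobolev0 s (F j)) ->
  sobolev0 s (fun a x => \sum_(j <- r) F j a x).
Proof.
move=> sF; elim: r => [|j r IH].
  rewrite (_ : (fun _ _ => _) = fun _ _ => 0); first exact: sobolev0_0.
  by apply/funext => a; apply/funext => x; rewrite big_nil.
rewrite (_ : (fun _ _ => _) =
    fun a x => 1 * F j a x + \sum_(k <- r) F k a x).
  exact: sobolev0_lin.
by apply/funext => a; apply/funext => x; rewrite big_cons mul1r.
Qed.

(** The shifted jet is that of D_i u. Testing u against D^(a+e_i) psi directly, or testing first
    order against the test function D^a psi, gives two expressions for the same integral; comparing
    them identifies the weak derivative of D_i u. The approximants are the D_i phi. *)
Lemma sobolev0_shift s i u : sobolev0 s.+1 u ->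
  sobolev0 s (fun a => u (mi_succ a i)).
Proof.
move=> /sobolev0P[su hu]; apply/sobolev0P; split => [a sa|e /hu [phi tphi hphi]].
  have [Lu wu] := su (mi_succ a i) (ltac:(by rewrite mi_order_succ)).
  have [Li wi] := su (mi_succ mi0 i) (ltac:(by rewrite mi_order_succ mi_order0)).
  split => //; apply/weak_derivativeP => psi tpsi.
  have tD := test_function_mi_deriv a tpsi.
  have spsi : smooth psi by case: tpsi.
  move/weak_derivativeP : wu => /(_ _ tpsi); rewrite mi_order_succ.
  move/weak_derivativeP : wi => /(_ _ tD); rewrite mi_order_succ mi_order0.
  rewrite (mi_deriv_succ _ _ spsi) mi_deriv_succ; last by case: tD.
  set w := flatten [seq nseq (a j) j | j <- enum 'I_n].
  have -> : mi_deriv a ('D_('e_i) psi) = partials (i :: w) psi.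
    rewrite -[LHS]/(partials w (partials [:: i] psi)) -partials_cat.
    by apply: perm_partials => //; rewrite perm_catC.
  rewrite mi_deriv0.
  move=> /= -> ; rewrite expr1 mulN1r exprS mulN1r mulNr => /eqP.
  by rewrite eqr_opp => /eqP.
exists ('D_('e_i) phi); first exact: test_function_derive.
move=> a sa; rewrite -mi_deriv_succ; last by case: tphi.
by apply: hphi; rewrite mi_order_succ.
Qed.

Lemma sobolev0_divergence s (u : 'I_n -> jet R n) : vsobolev0 Omega s.+1 u ->
  sobolev0 s (divergence u).
Proof.
by move=> su; apply: sobolev0_sum => i; apply: sobolev0_shift; exact: su.
Qed.

(* Testing the weak derivative against the derivatives of the approximating
   test functions replaces the uniqueness of weak derivatives. *)
Lemma sobolev0_null z : sobolev0 1 z -> L2norm (z mi0) = 0 ->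
  forall a : multiindex n, (mi_order a <= 1)%N -> L2norm (z a) = 0.
Proof.
move=> sz z0 a a1; have /sobolev0P[wz hz] := sz.
have [La wa] := wz a a1; have [L0 _] := wz mi0 (ltac:(by rewrite mi_order0)).
apply/eqP/negPn/negP => b0.
have {}b0 : 0 < L2norm (z a) by rewrite lt0r b0 L2norm_ge0.
have [phi tphi] := hz _ b0.
move=> /(_ a a1); apply/negP; rewrite -leNgt.
have tD := test_function_mi_deriv a tphi.
have LD := test_function_L2 tD.
have L1 : L2 Omega (fun x => z a x - mi_deriv a phi x).
  rewrite (_ : (fun x => _) = fun x => (-1) * mi_deriv a phi x + z a x).
    exact: L2_lin.
  by apply/funext => x; rewrite mulN1r addrC.
have orth : L2inner Omega (mi_deriv a phi) (z a) = 0.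
  move/weak_derivativeP : wa => /(_ _ tD) h.
  have : L2inner Omega (z mi0) (mi_deriv a (mi_deriv a phi)) = 0.
    apply/eqP; rewrite -normr_le0 (le_trans (L2inner_le _ _))//.
      exact: test_mi_deriv_L2.
    by rewrite z0 mul0r.
  rewrite h L2innerC => /eqP; rewrite mulf_eq0 signr_eq0 => /eqP.
  by [].
have : L2norm (z a) * L2norm (z a) <=
    L2norm (fun x => z a x - mi_deriv a phi x) * L2norm (z a).
  rewrite -expr2 L2norm_sqr//; apply: le_trans (L2inner_le L1 La).
  rewrite (_ : (fun x => z a x - _) = fun x => (-1) * mi_deriv a phi x + z a x).
    by rewrite L2inner_linl// orth mulr0 add0r ler_norm.
  by apply/funext => x; rewrite mulN1r addrC.
by rewrite ler_pM2r.
Qed.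

(** At order at most 1 a multi-index is 0 or some e_i, so a single integration by parts shows that
    classical derivatives are weak ones. *)
Lemma sobolev0_test phi : test_function Omega phi -> sobolev0 1 (jet_of phi).
Proof.
move=> tphi; apply/sobolev0P; split=> [a a1|e e0].
  split; first exact: test_mi_deriv_L2.
  apply/weak_derivativeP => psi tpsi.
  have [->|[i ->]] := mi_order_le1 a1.
    by rewrite /jet_of !mi_deriv0 mi_order0 mul1r.
  rewrite mi_order_succ mi_order0 expr1 mulN1r /jet_of.
  have spsi : smooth psi by case: tpsi.
  have sphi : smooth phi by case: tphi.
  rewrite (mi_deriv_succ _ _ spsi) (mi_deriv_succ _ _ sphi).
  by rewrite !mi_deriv0 L2inner_by_parts// opprK.
exists phi => // a a1; rewrite /jet_of (_ : (fun x => _) = fun=> 0).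
  by rewrite L2norm_0.
by apply/funext => x; rewrite subrr.
Qed.

End sobolev_theory.

(** * Dual norms *)

Section finite_sums.
Context {R : realType} {I : finType} (P : pred I).
Implicit Types p q : I -> R.

(** Sum 2 (p_i b) (q_i a) <= (p_i b)^2 + (q_i a)^2 and divide by 2 a b; when a or b is 0 every
    product vanishes. *)
Lemma sum_CauchySchwarz p q :
  \sum_(i | P i) p i * q i <=
  Num.sqrt (\sum_(i | P i) p i ^+ 2) * Num.sqrt (\sum_(i | P i) q i ^+ 2).
Proof.
have sq0 (f : I -> R) : 0 <= \sum_(i | P i) f i ^+ 2.
  by rewrite sumr_ge0// => ? _; exact: sqr_ge0.
set a := Num.sqrt _; set b := Num.sqrt _.
have a2 : \sum_(i | P i) p i ^+ 2 = a ^+ 2 by rewrite sqr_sqrtr.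
have b2 : \sum_(i | P i) q i ^+ 2 = b ^+ 2 by rewrite sqr_sqrtr.
have a0 : 0 <= a by exact: sqrtr_ge0.
have b0 : 0 <= b by exact: sqrtr_ge0.
have z (f g : I -> R) : \sum_(i | P i) f i ^+ 2 = 0 ->
    \sum_(i | P i) f i * g i = 0.
  move=> f0; rewrite big1// => i Pi.
  have /psumr_eq0P/(_ f0 _ Pi)/eqP : forall i, P i -> 0 <= f i ^+ 2.
    by move=> ? _; exact: sqr_ge0.
  by rewrite sqrf_eq0 => /eqP ->; rewrite mul0r.
have [a0'|a0'] := eqVneq a 0; first by rewrite z ?mulr_ge0// a2 a0' expr0n.
have [b0'|b0'] := eqVneq b 0.
  under eq_bigr do rewrite mulrC; rewrite z ?mulr_ge0//.
  by rewrite b2 b0' expr0n.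
have ab : 0 < a * b by rewrite mulr_gt0// lt0r ?a0' ?b0'.
rewrite -(ler_pM2l ab) mulr_sumr -(ler_pM2l (ltr0n _ 2)) mulr_sumr.
apply: (@le_trans _ _ (\sum_(i | P i) (p i ^+ 2 * b ^+ 2 + q i ^+ 2 * a ^+ 2))).
  apply: ler_sum => i _; rewrite -subr_ge0.
  rewrite (_ : _ - _ = (p i * b - q i * a) ^+ 2) ?sqr_ge0//; ring.
rewrite big_split/= -!mulr_suml a2 b2 le_eqVlt; apply/orP; left; apply/eqP; ring.
Qed.

(** Since r is only bounded by c p + q, the triangle inequality for the L^2 norms of the components
    can be fed in directly. *)
Lemma sum_Minkowski p q (c : R) (r : I -> R) :
  (forall i, P i -> 0 <= r i <= c * p i + q i) -> 0 <= c ->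
  Num.sqrt (\sum_(i | P i) r i ^+ 2) <=
  c * Num.sqrt (\sum_(i | P i) p i ^+ 2) + Num.sqrt (\sum_(i | P i) q i ^+ 2).
Proof.
move=> rpq c0.
have sq0 (f : I -> R) : 0 <= \sum_(i | P i) f i ^+ 2.
  by rewrite sumr_ge0// => ? _; exact: sqr_ge0.
have CS := sum_CauchySchwarz p q.
rewrite -(@ler_pXn2r _ 2)// ?nnegrE ?addr_ge0 ?mulr_ge0 ?sqrtr_ge0//.
rewrite sqr_sqrtr//.
apply: (@le_trans _ _ (\sum_(i | P i)
    (c ^+ 2 * p i ^+ 2 + (2 * c) * (p i * q i) + q i ^+ 2))).
  apply: ler_sum => i Pi; have /andP[r0 rle] := rpq i Pi.
  rewrite (_ : _ + _ = (c * p i + q i) ^+ 2); last by ring.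
  by rewrite ler_pXn2r ?nnegrE// (le_trans r0).
rewrite !big_split/= -!mulr_sumr.
rewrite [leRHS]sqrrD exprMn !sqr_sqrtr// lerD2r lerD2l -[leRHS]mulr_natl -!mulrA.
by rewrite ler_pM2l// ler_wpM2l.
Qed.

End finite_sums.

(** * Functionals on jets and the one-dimensional extension *)

Section jets.
Context {R : realType} {n : nat} (Omega : set 'rV[R]_n).
Implicit Types (u v w z : jet R n) (f : jet R n -> R) (c : R).

Local Notation L2norm := (L2norm Omega).
Local Notation seminorm := (seminorm Omega).
Local Notation sobolev0 := (sobolev0 Omega).

Definition jet_lin c u v : jet R n := fun a x => c * u a x + v a x.

Definition jet0 : jet R n := fun _ _ => 0.

Lemma seminorm_lin s c u v : sobolev0 s u -> sobolev0 s v ->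
  seminorm s (jet_lin c u v) <= `|c| * seminorm s u + seminorm s v.
Proof.
move=> su sv; apply: sum_Minkowski => // a /eqP aE.
have ao : (mi_order [ffun i => a i : nat] <= s)%N.
  by rewrite -[leqRHS]aE /mi_order; under eq_bigr do rewrite ffunE.
rewrite L2norm_ge0/= L2norm_lin_le//; first exact: sobolev0_L2 su ao.
exact: sobolev0_L2 sv ao.
Qed.

Lemma seminorm0 s : seminorm s jet0 = 0.
Proof.
have [K [K0 hK]] := @seminorm_le R n Omega s.
apply/eqP; rewrite eq_le seminorm_ge0 andbT -(mulr0 K).
by apply: hK => // a _; rewrite L2norm_0.
Qed.

Lemma seminorm_scale s c u : sobolev0 s u ->
  seminorm s (jet_lin c u jet0) <= `|c| * seminorm s u.
Proof.
move=> su; rewrite -[leRHS]addr0 -[X in _ + X](seminorm0 s).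
by apply: seminorm_lin => //; exact: sobolev0_0.
Qed.

(** This makes a functional on jets depend only on the function: f is bounded by the full Sobolev
    norm, which [sobolev0_null] annihilates. *)
Lemma dual_null f z : dual_sobolev Omega 1 f -> sobolev0 1 z ->
  L2norm (z mi0) = 0 -> f z = 0.
Proof.
move=> [_ [C fC]] sz z0; have [K [K0 hK]] := @sobolev_norm_le R n Omega 1.
have : sobolev_norm Omega 1 z = 0.
  apply/eqP; rewrite eq_le sobolev_norm_ge0 andbT -(mulr0 K).
  by apply: hK => // a a1; rewrite (sobolev0_null sz).
by have := fC z sz => /[swap] ->; rewrite mulr0 normr_le0 => /eqP.
Qed.

Lemma dual_lin f c u v : dual_sobolev Omega 1 f -> sobolev0 1 u ->
  sobolev0 1 v -> f (jet_lin c u v) = c * f u + f v.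
Proof. by move=> [h _]; exact: h. Qed.

Lemma dual0 f : dual_sobolev Omega 1 f -> f jet0 = 0.
Proof.
by move=> hf; apply: (dual_null hf); [exact: sobolev0_0|exact: L2norm_0].
Qed.

Lemma dual_scale f c u : dual_sobolev Omega 1 f -> sobolev0 1 u ->
  f (jet_lin c u jet0) = c * f u.
Proof.
by move=> hf su; rewrite dual_lin// ?dual0 ?addr0//; exact: sobolev0_0.
Qed.

Lemma L2norm_scale c (g : 'rV[R]_n -> R) : L2 Omega g ->
  L2norm (fun x => c * g x + 0) <= `|c| * L2norm g.
Proof.
by move=> Lg; have := L2norm_lin_le c Lg (L2_0 Omega); rewrite L2norm_0 addr0.
Qed.

Lemma nonzero_scale c s u : c != 0 -> sobolev0 s u -> nonzero Omega u ->
  nonzero Omega (jet_lin c u jet0).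
Proof.
move=> c0 su; apply: contra => /eqP u0.
have Lu : L2 Omega (u mi0) by apply: (sobolev0_L2 su); rewrite mi_order0.
have Lcu : L2 Omega (jet_lin c u jet0 mi0) by apply: L2_lin => //; exact: L2_0.
rewrite -normr_le0 (_ : u mi0 = fun x => c^-1 * jet_lin c u jet0 mi0 x + 0).
  rewrite ger0_norm ?L2norm_ge0//.
  by rewrite (le_trans (L2norm_scale _ Lcu))// u0 mulr0.
by apply/funext => x; rewrite /jet_lin /jet0 !addr0 mulKf.
Qed.

(* The Hahn-Banach extension across the hyperplane of zero-mean functions: the
   constant c separates the values f z - M |z| and f z + M |z| over the affine
   hyperplane m z = 1. *)
Lemma hyperplane_extension f (m : jet R n -> R) M : dual_sobolev Omega 1 f ->
  (forall c u v, sobolev0 1 u -> sobolev0 1 v ->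
    m (jet_lin c u v) = c * m u + m v) ->
  0 <= M ->
  (forall v, sobolev0 1 v -> m v = 0 -> `|f v| <= M * seminorm 1 v) ->
  exists c, forall v, sobolev0 1 v -> `|f v - c * m v| <= M * seminorm 1 v.
Proof.
move=> hf mlin M0 fM.
have m0 : m jet0 = 0.
  have := mlin 1 jet0 jet0 (sobolev0_0 _ _) (sobolev0_0 _ _).
  rewrite (_ : jet_lin _ _ _ = jet0).
    by rewrite mul1r => /eqP; rewrite -subr_eq0 opprD addNKr oppr_eq0 => /eqP.
  by apply/funext => a; apply/funext => x; rewrite /jet_lin mulr0 addr0.
have [[w [sw mw]]|nw] := pselect (exists w, sobolev0 1 w /\ m w <> 0); last first.
  exists 0 => v sv; rewrite mul0r subr0; apply: fM => //.
  by apply: contrapT => mv; apply: nw; exists v.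
pose H := [set z | sobolev0 1 z /\ m z = 1].
have Hscale v : sobolev0 1 v -> m v != 0 -> H (jet_lin (m v)^-1 v jet0).
  move=> sv mv; split; first by apply: sobolev0_lin => //; exact: sobolev0_0.
  by rewrite mlin// ?m0 ?addr0 ?mulVf//; exact: sobolev0_0.
have [w1 [sw1 mw1]] : H !=set0.
  by eexists; apply: (Hscale w) => //; exact/eqP.
have key y z : H y -> H z -> f y - M * seminorm 1 y <= f z + M * seminorm 1 z.
  move=> [sy my] [sz mz]; rewrite lerBlDr -addrA -lerBlDl.
  have sd : sobolev0 1 (jet_lin (-1) z y) by exact: sobolev0_lin.
  have := fM _ sd; rewrite mlin// my mz mulr1 addNr => /(_ erefl).
  have -> : f (jet_lin (-1) z y) = f y - f z by rewrite dual_lin// mulN1r addrC.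
  move=> h; apply: (le_trans (ler_norm _)); apply: (le_trans h).
  rewrite -mulrDr ler_wpM2l//.
  by have := seminorm_lin (-1) sz sy; rewrite normrN1 mul1r.
pose S := [set f y - M * seminorm 1 y | y in H].
have Sub z : H z -> ubound S (f z + M * seminorm 1 z).
  by move=> Hz _ [y Hy <-]; exact: key.
have S0 : S !=set0 by eexists; exists w1.
exists (sup S) => v sv; have [mv|mv] := eqVneq (m v) 0.
  by rewrite mv mulr0 subr0; exact: fM.
set z := jet_lin (m v)^-1 v jet0; have Hz := Hscale v sv mv.
have fz : `|f z - sup S| <= M * seminorm 1 z.
  rewrite ler_norml; apply/andP; split.
    by rewrite lerBrDl lerBlDl addrC; apply: ge_sup => //; exact: Sub.
  rewrite lerBlDl -lerBlDr; apply: ub_le_sup; last by exists z.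
  by exists (f w1 + M * seminorm 1 w1); exact: Sub.
have nm : 0 < `|m v| by rewrite normr_gt0.
have -> : f v - sup S * m v = m v * (f z - sup S).
  by rewrite dual_scale// mulrBr mulVKf// [m v * _]mulrC.
rewrite normrM -ler_pdivlMl//; apply: (le_trans fz).
rewrite mulrCA ler_wpM2l//; apply: le_trans (seminorm_scale _ sv) _.
by rewrite normfV.
Qed.

(** Positivity of the seminorm is assumed because the inverse of 0 in [\bar R] is +oo, so a
    vanishing denominator would spoil the bound. *)
Lemma dual_norm_le f M : 0 <= M ->
  (forall v, sobolev0 1 v -> f v <= M * seminorm 1 v) ->
  (forall v, sobolev0 1 v -> nonzero Omega v -> 0 < seminorm 1 v) ->
  (dual_norm Omega 1 f <= M%:E)%E.
Proof.
move=> M0 fM pos; apply: ge_ereal_sup => _ [v [sv nv] <-].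
have p := pos v sv nv.
by rewrite inver gt_eqF// -EFinM lee_fin ler_pdivrMr// fM.
Qed.

End jets.

Section ereal_inverse.
Context {R : realType}.
Local Open Scope ereal_scope.

(** On [0, +oo] inversion is an order-reversing involution that exchanges 0 and +oo. *)
Lemma ereal_sup_inve (S : set (\bar R)) :
  S !=set0 -> (forall y, S y -> 0 <= y) ->
  ereal_sup [set y^-1 | y in S] = (ereal_inf S)^-1.
Proof.
move=> [y0 Sy0] S0.
have inf0 : 0 <= ereal_inf S by apply: le_ereal_inf_tmp => y /S0.
have sup0 : 0 <= ereal_sup [set y^-1 | y in S].
  apply: le_ereal_sup_tmp; exists (y0^-1); first by exists y0.
  by rewrite inve_ge0 S0.
apply/eqP; rewrite eq_le; apply/andP; split.
  apply: ge_ereal_sup => _ [y Sy <-]; rewrite lee_pV2 ?inE ?(S0 y)//.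
  exact: ereal_inf_lbound.
rewrite inve_ple ?inE//; apply: le_ereal_inf_tmp => y Sy.
rewrite inve_ple ?inE ?(S0 y)//; apply: ereal_sup_ubound.
by exists y.
Qed.

End ereal_inverse.

(** * The mean as a linear functional *)

Section zero_mean.
Context {R : realType} {n : nat} (Omega : set 'rV[R]_n).
Context (M : R) (M_gt0 : 0 < M) (Omega_bounded : Omega `<=` cube M).
Implicit Types (u v w z : jet R n) (c : R).

Lemma sobolev0_L2_mi0 s u : sobolev0 Omega s u -> L2 Omega (u mi0).
Proof. by move=> su; apply: (sobolev0_L2 su); rewrite mi_order0. Qed.

(** On the cube, which has finite measure, |t| <= 1 + t^2 dominates g by an integrable function.
    Without integrability the mean would not be linear. *)
Lemma integrable_L2 g : L2 Omega g ->
  (leb R n).-integrable setT (EFin \o (g \_ Omega)).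
Proof.
move=> Lg; have mQ := @measurable_box R n (fun=> - M) (fun=> M).
have mg := L2_measurable Lg.
have ig : (leb R n).-integrable (cube M)
    (EFin \o (fun x => 1 + (g \_ Omega) x ^+ 2)).
  have i1 : (leb R n).-integrable (cube M) (EFin \o (fun=> 1 : R)).
    apply: measurable_bounded_integrable => //.
      rewrite [X in (X < _)%E](leb_box (b := fun=> M)) ?ltry// => i.
      by rewrite gtrN.
    by exists 1; split=> // y y1 x _ /=; rewrite normr1 ltW.
  have i2 : (leb R n).-integrable (cube M)
      (EFin \o (fun x => (g \_ Omega) x ^+ 2)).
    by apply: (integrableS measurableT) => //; exact: Lfun2_integrable_sqr.
  exact: (integrableD mQ i1 i2).
have -> : EFin \o (g \_ Omega) = (EFin \o (g \_ Omega)) \_ (cube M).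
  apply/funext => x; rewrite [RHS]patchE; case: ifPn => // /negP xM /=.
  rewrite patchE; case: ifPn => // /set_mem /Omega_bounded Mx.
  by exfalso; apply: xM; exact/mem_set.
apply/(integrable_mkcond _ mQ); apply: le_integrable ig => //.
  by apply/measurable_EFinP; exact: measurable_funTS.
move=> x _ /=; rewrite lee_fin; set t := (g \_ Omega) x.
rewrite [leRHS]ger0_norm ?addr_ge0 ?sqr_ge0// -(real_normK (num_real t)).
by have := normr_ge0 t; move: (`|t|) => r r0; nra.
Qed.

Definition mean v : R := \int[leb R n]_(x in Omega) v mi0 x.

Lemma mean_lin c u v : sobolev0 Omega 1 u -> sobolev0 Omega 1 v ->
  mean (jet_lin c u v) = c * mean u + mean v.
Proof.
move=> su sv.
have iu := integrable_L2 (sobolev0_L2_mi0 su).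
have iv := integrable_L2 (sobolev0_L2_mi0 sv).
rewrite /mean !(Rintegral_mkcond (leb R n) Omega) -RintegralZl//.
rewrite -RintegralD//; last first.
  by have := integrableZl measurableT c iu; apply: eq_integrable.
apply: eq_Rintegral => x _; rewrite !patchE; case: ifP => // _.
by rewrite mulr0 addr0.
Qed.

Lemma constant_functionalE c v : sobolev0 Omega 1 v ->
  constant_functional Omega c v = c * mean v.
Proof.
move=> sv; have iv := integrable_L2 (sobolev0_L2_mi0 sv).
rewrite /constant_functional /mean !(Rintegral_mkcond (leb R n) Omega).
rewrite -RintegralZl//; apply: eq_Rintegral => x _; rewrite !patchE.
by case: ifP => // _; rewrite mulr0.
Qed.

End zero_mean.

(** * Sign changes and null vector fields *)

Section vector_fields.
Context {R : realType} {n : nat} (Omega : set 'rV[R]_n).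
Implicit Types (u : 'I_n -> jet R n).

(** The dual norms are suprema without absolute values, and [gradient] carries a minus sign; both
    call for replacing u by -u. Writing -u as a [jet_lin] puts it within reach of the linearity
    lemmas. *)
Definition vjet_opp u : 'I_n -> jet R n := fun i => jet_lin (-1) (u i) jet0.

Lemma vjet_opp_sobolev0 s u :
  vsobolev0 Omega s u -> vsobolev0 Omega s (vjet_opp u).
Proof. by move=> su i; apply: sobolev0_lin => //; exact: sobolev0_0. Qed.

Lemma L2norm_opp (g : 'rV[R]_n -> R) :
  L2norm Omega (fun x => -1 * g x + 0) = L2norm Omega g.
Proof.
rewrite /L2norm (_ : EFin \o _ = (\- (EFin \o (g \_ Omega)))%E).
  by rewrite oppe_Lnorm.
apply/funext => x; rewrite /= !patchE; case: ifP => _; last by rewrite oppr0.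
by rewrite mulN1r addr0 EFinN.
Qed.

Lemma vseminorm_opp s u : vseminorm Omega s (vjet_opp u) = vseminorm Omega s u.
Proof.
congr Num.sqrt; apply: eq_bigr => i _; congr (_ ^+ 2); congr Num.sqrt.
by apply: eq_bigr => a _; rewrite [L2norm _ _]L2norm_opp.
Qed.

Lemma vnonzero_opp u : vnonzero Omega u -> vnonzero Omega (vjet_opp u).
Proof. by move=> [i ui]; exists i; rewrite /nonzero [L2norm _ _]L2norm_opp. Qed.

Lemma divergence_opp u :
  divergence (vjet_opp u) = jet_lin (-1) (divergence u) jet0.
Proof.
apply/funext => a; apply/funext => x; rewrite /divergence /jet_lin /jet0 addr0.
by rewrite mulr_sumr; apply: eq_bigr => i _; rewrite /vjet_opp /jet_lin addr0.
Qed.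

Lemma vseminorm_ge0 s u : 0 <= vseminorm Omega s u.
Proof. exact: sqrtr_ge0. Qed.

Lemma seminorm_le_vseminorm s u i : seminorm Omega s (u i) <= vseminorm Omega s u.
Proof.
rewrite -(@ler_pXn2r _ 2)// ?nnegrE ?vseminorm_ge0 ?seminorm_ge0//.
rewrite [leRHS]sqr_sqrtr; last by rewrite sumr_ge0// => ? _; exact: sqr_ge0.
by rewrite (bigD1 i)//= lerDl sumr_ge0// => ? _; exact: sqr_ge0.
Qed.

Lemma L2norm_sum_eq0 I (r : seq I) (F : I -> 'rV[R]_n -> R) :
  (forall i, L2 Omega (F i)) -> (forall i, L2norm Omega (F i) = 0) ->
  L2norm Omega (fun x => \sum_(i <- r) F i x) = 0.
Proof.
move=> LF F0; suff [] : L2 Omega (fun x => \sum_(i <- r) F i x) /\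
  L2norm Omega (fun x => \sum_(i <- r) F i x) = 0 by [].
elim: r => [|i r [LS S0]].
  under eq_fun do rewrite big_nil; split; [exact: L2_0|exact: L2norm_0].
have -> : (fun x => \sum_(j <- i :: r) F j x) =
    fun x => 1 * F i x + \sum_(j <- r) F j x.
  by apply/funext => x; rewrite big_cons mul1r.
split; first exact: L2_lin.
apply/eqP; rewrite eq_le L2norm_ge0 andbT.
by rewrite (le_trans (L2norm_lin_le _ _ _))// F0 S0 mulr0 addr0.
Qed.

(** Failure of [vnonzero] concerns only the order-zero components; [sobolev0_null] carries it over
    to the first derivatives that make up the divergence. *)
Lemma divergence_null u : vsobolev0 Omega 2 u -> ~ vnonzero Omega u ->
  L2norm Omega (divergence u mi0) = 0.
Proof.
move=> su nu; apply: L2norm_sum_eq0 => i.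
  by apply: (sobolev0_L2 (su i)); rewrite mi_order_succ mi_order0.
apply: (sobolev0_null (sobolev0_le _ (su i))); rewrite ?mi_order_succ ?mi_order0//.
by apply/eqP; apply: contrapT => /negP ui; apply: nu; exists i.
Qed.

End vector_fields.

(** * Comparison of the quotient norm with the norm of the gradient *)

Section inf_sup.
Context {R : realType} {n : nat} (Omega : set 'rV[R]_n).
Context (M : R) (M_gt0 : 0 < M) (Omega_bounded : Omega `<=` cube M).
Context (D : R) (D_ge0 : 0 <= D).
Context (poincare : forall v, sobolev0 Omega 1 v ->
  L2norm Omega (v mi0) <= D * seminorm Omega 1 v).
Context (K : R) (K_gt0 : 0 < K).
Context (right_inverse : forall v, sobolev0 Omega 1 v -> zero_mean Omega v ->
  exists u : 'I_n -> jet R n, [/\ vsobolev0 Omega 2 u,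
    divergence u mi0 = v mi0 %[ae leb R n in Omega] &
    vseminorm Omega 2 u <= K * seminorm Omega 1 v]).
Implicit Types (f : jet R n -> R) (u : 'I_n -> jet R n) (v : jet R n) (c : R).

Local Notation V := (sobolev0 Omega 1).
Local Notation W := (vsobolev0 Omega 2).

Lemma seminorm_gt0 v : V v -> nonzero Omega v -> 0 < seminorm Omega 1 v.
Proof.
move=> sv nv; rewrite lt0r seminorm_ge0 andbT; apply: contra nv => /eqP v0.
by rewrite eq_le L2norm_ge0 andbT (le_trans (poincare sv))// v0 mulr0.
Qed.

(** The Poincaré inequality is used twice: on the first derivatives of u_i, which lie in H^1_0 by
    [sobolev0_shift], and then on u_i itself. *)
Lemma vseminorm_gt0 u : W u -> vnonzero Omega u -> 0 < vseminorm Omega 2 u.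
Proof.
move=> su [i ui]; rewrite lt0r vseminorm_ge0 andbT; apply: contra ui => /eqP u0.
have seminorm0_null v : V v ->
    (forall a, mi_order a = 1%N -> L2norm Omega (v a) = 0) ->
    L2norm Omega (v mi0) = 0.
  move=> sv v0; have [C [C0 hC]] := @seminorm_le R n Omega 1.
  apply/eqP; rewrite eq_le L2norm_ge0 andbT (le_trans (poincare sv))//.
  rewrite mulr_ge0_le0// -(mulr0 C); apply: hC => // a a1.
  by rewrite v0.
apply/eqP; apply: (seminorm0_null (u i)); first exact: (sobolev0_le _ (su i)).
move=> a a1; have [b [j [-> /mi_order_eq0 ->]]] := mi_order_gt0 a1.
apply: (seminorm0_null (fun a => u i (mi_succ a j))).
  exact: sobolev0_shift (su i).
move=> d d1; apply/eqP; rewrite eq_le L2norm_ge0 andbT -u0.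
apply: le_trans (seminorm_le_vseminorm _ _ _ i).
have := L2norm_le_seminorm Omega (u i) (mi_succ d j).
by rewrite mi_order_succ d1.
Qed.

Section functional.
Context (f : jet R n -> R) (f_dual : dual_sobolev Omega 1 f).

Let f_opp v : V v -> f (jet_lin (-1) v jet0) = - f v.
Proof. by move=> sv; rewrite (dual_scale _ f_dual)// mulN1r. Qed.

Lemma dual_divergence_opp u : W u ->
  f (divergence (vjet_opp u)) = - f (divergence u).
Proof. by move=> su; rewrite divergence_opp f_opp//; exact: sobolev0_divergence. Qed.

Lemma dual_divergence_null u : W u -> ~ vnonzero Omega u -> f (divergence u) = 0.
Proof.
move=> su nu; apply: (dual_null f_dual); first exact: sobolev0_divergence.
exact: divergence_null.
Qed.

(** The supremum controls -f (div w) for nonzero w only: the other sign comes from -u, and null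
    fields contribute 0. *)
Lemma dual_divergence_le (N : R) : 0 <= N ->
  (vdual_norm Omega 2 (gradient f) <= N%:E)%E ->
  forall u, W u -> `|f (divergence u)| <= N * vseminorm Omega 2 u.
Proof.
move=> N0 fN u su; have [nu|nu] := pselect (vnonzero Omega u); last first.
  by rewrite dual_divergence_null// normr0 mulr_ge0// vseminorm_ge0.
have bd w : W w -> vnonzero Omega w ->
    - f (divergence w) <= N * vseminorm Omega 2 w.
  move=> sw nw; have w0 := vseminorm_gt0 sw nw.
  have : ((gradient f w)%:E / (vseminorm Omega 2 w)%:E <= N%:E)%E.
    by apply: le_trans fN; apply: ereal_sup_ubound; exists w.
  by rewrite inver gt_eqF// -EFinM lee_fin ler_pdivrMr.
have := bd _ (vjet_opp_sobolev0 su) (vnonzero_opp nu).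
rewrite dual_divergence_opp// opprK vseminorm_opp => h.
by rewrite ler_norml h lerNl bd.
Qed.

Lemma dual_zero_mean_le (N : R) : 0 <= N ->
  (vdual_norm Omega 2 (gradient f) <= N%:E)%E ->
  forall v, V v -> mean Omega v = 0 -> `|f v| <= N * K * seminorm Omega 1 v.
Proof.
move=> N0 fN v sv v0; have [u [su uv ule]] := right_inverse sv v0.
have sd := sobolev0_divergence su.
(* The jets of div u and v agree only at order zero and almost everywhere; their difference is a
   null jet, on which f vanishes. *)
have sz : V (jet_lin (-1) (divergence u) v) by exact: sobolev0_lin.
have Lz := sobolev0_L2_mi0 sz.
have : f (jet_lin (-1) (divergence u) v) = 0.
  apply: (dual_null f_dual) => //; apply: (L2norm_ae0 Lz).
  apply: filterS uv => x h Ox; rewrite /jet_lin h//.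
  by rewrite mulN1r addNr.
rewrite (dual_lin _ f_dual)// mulN1r addrC => /eqP; rewrite subr_eq0 => /eqP ->.
by rewrite (le_trans (dual_divergence_le N0 fN su))// -mulrA ler_wpM2l.
Qed.

Lemma dual_extension (L : R) : 0 <= L ->
  (forall v, V v -> mean Omega v = 0 -> `|f v| <= L * seminorm Omega 1 v) ->
  exists c, forall v, V v ->
    `|f v - constant_functional Omega c v| <= L * seminorm Omega 1 v.
Proof.
move=> L0 fL; have mlin := mean_lin M_gt0 Omega_bounded.
have [c hc] := hyperplane_extension f_dual mlin L0 fL.
exists c => v sv; rewrite (constant_functionalE M_gt0 Omega_bounded)//.
exact: hc.
Qed.

Lemma quotient_norm_le (L : R) : 0 <= L ->
  (forall v, V v -> mean Omega v = 0 -> `|f v| <= L * seminorm Omega 1 v) ->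
  (quotient_norm Omega f <= L%:E)%E.
Proof.
move=> L0 /(dual_extension L0)[c hc]; apply: ge_ereal_inf.
eexists; first by exists c.
apply: dual_norm_le => // [v sv|v sv nv]; last exact: seminorm_gt0.
by rewrite (le_trans (ler_norm _))// hc.
Qed.

(** The extension with bound 0 turns its inequality into the equality f = c times the mean. Both
    positivity results below reduce to this. *)
Lemma zero_on_zero_mean : (forall v, V v -> mean Omega v = 0 -> f v = 0) ->
  ~ nonconstant Omega f.
Proof.
move=> f0; apply; have [v sv mv|c hc] := @dual_extension 0 (lexx _).
  by rewrite f0// normr0 mul0r.
exists c => v /hc; rewrite mul0r normr_le0 subr_eq0 => /eqP.
by [].
Qed.

(** Constants vanish on zero-mean functions, so a zero-mean v with f v nonzero bounds the norm of f
    - c from below by |f v| / |v|_1, whatever c is. An infimum <= 0 thus forces f to vanish on all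
    zero-mean functions. *)
Lemma quotient_norm_gt0 : nonconstant Omega f -> (0 < quotient_norm Omega f)%E.
Proof.
move=> nf; rewrite ltNge; apply/negP => q0; move: nf.
apply: zero_on_zero_mean => v sv mv; apply/eqP/negPn/negP => fv.
have nv : nonzero Omega v.
  by apply: contra fv => /eqP v0; rewrite (dual_null f_dual sv).
have v0 := seminorm_gt0 sv nv.
have e0 : 0 < `|f v| / seminorm Omega 1 v by rewrite divr_gt0// normr_gt0.
have qe : (quotient_norm Omega f < (`|f v| / seminorm Omega 1 v)%:E)%E.
  by apply: (le_lt_trans q0); rewrite lte_fin.
have [_ [c _ <-]] := ereal_inf_lt qe.
rewrite ltNge => /negP; apply.
have constN z : V z -> mean Omega z = 0 -> constant_functional Omega c z = 0.
  by move=> sz mz; rewrite (constant_functionalE M_gt0 Omega_bounded)// mz mulr0.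
have bd z : V z -> nonzero Omega z -> mean Omega z = 0 ->
    ((f z / seminorm Omega 1 z)%:E <=
     dual_norm Omega 1 (fun v => f v - constant_functional Omega c v)%R)%E.
  move=> sz nz mz; apply: ereal_sup_ubound; exists z => //=.
  by rewrite constN// subr0 inver gt_eqF ?seminorm_gt0.
(* The supremum has no absolute value: a negative f v is handled by passing to -v. *)
have [f0|f0] := leP 0 (f v); first by rewrite ger0_norm// bd.
have sv' : V (jet_lin (-1) v jet0) by apply: sobolev0_lin => //; exact: sobolev0_0.
have nv' : nonzero Omega (jet_lin (-1) v jet0).
  by apply: (nonzero_scale _ sv nv); rewrite oppr_eq0 oner_eq0.
have mv' : mean Omega (jet_lin (-1) v jet0) = 0.
  rewrite (mean_lin M_gt0 Omega_bounded)//; last exact: sobolev0_0.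
  rewrite mv mulr0 add0r /mean.
  by rewrite /Rintegral integral0_eq.
apply: le_trans (bd _ sv' nv' mv'); rewrite ltr0_norm// lee_fin f_opp//.
rewrite ler_pM2l ?oppr_gt0// lef_pV2 ?posrE ?seminorm_gt0//.
by rewrite (le_trans (seminorm_scale _ sv))// normrN1 mul1r.
Qed.

Lemma quotient_norm_lty : (quotient_norm Omega f < +oo)%E.
Proof.
have [_ [C fC]] := f_dual; have [A [A0 hA]] := @sobolev_norm_le R n Omega 1.
(* [A] passes from components to the Sobolev norm; in [D + 1], the [D] bounds the order-zero
   component by Poincaré and the 1 bounds those of order one. The absolute value is there because C
   may be negative. *)
apply: (@le_lt_trans _ _ (`|C| * (A * (D + 1)))%:E); last exact: ltry.
apply: quotient_norm_le => [|v sv _]; first by rewrite !mulr_ge0// addr_ge0.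
rewrite (le_trans (fC v sv))//.
apply: (@le_trans _ _ (`|C| * sobolev_norm Omega 1 v)).
  by rewrite ler_wpM2r ?sobolev_norm_ge0// ler_norm.
rewrite -!mulrA ler_wpM2l//.
have S0 := seminorm_ge0 Omega 1 v.
apply: hA => [|a]; first by rewrite mulr_ge0// addr_ge0.
rewrite leq_eqVlt => /orP[/eqP a1|].
  have := L2norm_le_seminorm Omega v a; rewrite a1 => h.
  by apply: (le_trans h); rewrite mulrDl mul1r lerDr mulr_ge0.
rewrite ltnS leqn0 => /eqP/mi_order_eq0 ->.
by rewrite (le_trans (poincare sv))// mulrDl mul1r lerDl.
Qed.

Lemma vdual_norm_gt0 : nonconstant Omega f ->
  (0 < vdual_norm Omega 2 (gradient f))%E.
Proof.
move=> nf; rewrite ltNge; apply/negP => N0; move: nf.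
apply: zero_on_zero_mean => v sv mv.
have := dual_zero_mean_le (lexx _) N0 sv mv.
by rewrite !mul0r normr_le0 => /eqP.
Qed.

Lemma quotient_norm_vdual_norm (N : R) : 0 <= N ->
  vdual_norm Omega 2 (gradient f) = N%:E ->
  (quotient_norm Omega f <= (N * K)%:E)%E.
Proof.
move=> N0 NE; apply: quotient_norm_le; first by rewrite mulr_ge0// ltW.
by move=> v; apply: dual_zero_mean_le => //; rewrite NE.
Qed.

(** The map u -> -u permutes the admissible fields and absorbs the sign in [gradient], after which
    1/q factors out of the supremum. The dual norm may be +oo here. *)
Lemma sup_divergence (q : R) : 0 < q -> quotient_norm Omega f = q%:E ->
  ereal_sup
    [set ((f (divergence u))%:E /
          (quotient_norm Omega f * (vseminorm Omega 2 u)%:E))%E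
    | u in [set u | vsobolev0 Omega 2 u /\ vnonzero Omega u]] =
  (q^-1%:E * vdual_norm Omega 2 (gradient f))%E.
Proof.
move=> q0 ->; rewrite -ereal_sup_pZl ?invr_gt0//; congr ereal_sup.
have E u : W u -> vnonzero Omega u ->
    ((f (divergence u))%:E / (q%:E * (vseminorm Omega 2 u)%:E))%E =
    (q^-1%:E * ((gradient f (vjet_opp u))%:E /
      (vseminorm Omega 2 (vjet_opp u))%:E))%E.
  move=> su nu; have u0 := vseminorm_gt0 su nu.
  rewrite vseminorm_opp /gradient dual_divergence_opp// opprK.
  rewrite -EFinM !inver !gt_eqF ?mulr_gt0// -!EFinM; congr EFin.
  by rewrite invfM mulrCA.
have oppK u : vjet_opp (vjet_opp u) = u.
  apply/funext => i; apply/funext => a; apply/funext => x.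
  by rewrite /vjet_opp /jet_lin /jet0 !addr0 !mulN1r opprK.
apply/seteqP; split => [_ [u [su nu] <-]|_ [_ [u [su nu] <-] <-]] /=.
  rewrite E//; eexists; last by [].
  exists (vjet_opp u) => //; split; first exact: vjet_opp_sobolev0.
  exact: vnonzero_opp.
exists (vjet_opp u).
  by split; [exact: vjet_opp_sobolev0|exact: vnonzero_opp].
rewrite E ?oppK//; first exact: vjet_opp_sobolev0.
exact: vnonzero_opp.
Qed.

End functional.
End inf_sup.

(** * A nonconstant functional *)

Section nonconstant_functional.
Context {R : realType} {n : nat} (Omega : set 'rV[R]_n).
Context (M : R) (M_gt0 : 0 < M) (Omega_bounded : Omega `<=` cube M).

Lemma box_not_null (a b : 'I_n -> R) : (forall i, a i < b i) ->
  ~ {ae leb R n, forall x, ~ box a b x}.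
Proof.
move=> ab [N [mN N0 sub]].
have : (leb R n (box a b) <= leb R n N)%E.
  apply: le_measure; rewrite ?inE//; first exact: measurable_box.
  by move=> x bx; apply: sub => /= h; exact: h bx.
rewrite N0 leb_box// lee_fin leNgt => /negP; apply.
by apply: prodr_gt0 => i _; rewrite subr_gt0.
Qed.

Lemma bump_not_null (a b : 'I_n -> R) : (forall i, a i < b i) ->
  box a b `<=` Omega -> ~ {ae leb R n, forall x, Omega x -> bump a b x = 0}.
Proof.
move=> ab bO h; apply: (box_not_null ab); apply: filterS h => x h bx.
by have /bump_neq0 := bx; rewrite h ?eqxx//; exact: bO.
Qed.

Lemma nonneg_mean_eq0 (g : 'rV[R]_n -> R) : L2 Omega g -> (forall x, 0 <= g x) ->
  \int[leb R n]_(x in Omega) g x = 0 ->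
  {ae leb R n, forall x, Omega x -> g x = 0}.
Proof.
move=> Lg g0; rewrite Rintegral_mkcond => I0.
have ig := integrable_L2 M_gt0 Omega_bounded Lg.
have : (\int[leb R n]_x `|(EFin \o (g \_ Omega)) x| = 0)%E.
  rewrite -[RHS](congr1 EFin I0) /Rintegral fineK; last first.
    exact: (integrable_fin_num measurableT ig).
  apply: eq_integral => x _ /=; rewrite ger0_norm//.
  by rewrite patchE; case: ifP.
move/(ae_eq_integral_abs _ measurableT (measurable_int _ ig)).
by apply: filterS => x /(_ I) [] + Ox; rewrite patchE mem_set.
Qed.

(** Let f pair with the first bump. If f were c times the mean, the second bump would give 0 = c
    times a positive integral, so c = 0; the first bump would then have zero L^2 norm, though it is
    positive on a box of positive measure. *)
Lemma exists_nonconstant (i0 : 'I_n) : open Omega -> Omega !=set0 ->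
  exists f, dual_sobolev Omega 1 f /\ nonconstant Omega f.
Proof.
move=> oO [x0 Ox0].
have /nbhs_ballP[r /= r0 rO] : nbhs x0 Omega by exact: open_nbhs_nbhs.
pose h := r / 2; have h0 : 0 < h by rewrite divr_gt0.
have hr : h < r by rewrite /h ltr_pdivrMr// ltr_pMr// ltr1n.
have near (x : 'rV[R]_n) :
    (forall i, x0 0 i - h <= x 0 i <= x0 0 i + h) -> Omega x.
  move=> xh; apply: rO; split => // k i; rewrite ord1 /ball/= distrC.
  by rewrite (le_lt_trans _ hr)// ler_distl.
(* A cube around x0 is cut in two along coordinate i0. The closed halves share a face, but the open
   ones, where the bumps are nonzero, are disjoint. *)
pose a1 i := x0 0 i - h; pose b1 i := if i == i0 then x0 0 i else x0 0 i + h.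
pose a2 i := if i == i0 then x0 0 i else x0 0 i - h; pose b2 i := x0 0 i + h.
have ab1 i : a1 i < b1 i.
  by rewrite /a1 /b1; case: ifP => _; lra.
have ab2 i : a2 i < b2 i.
  by rewrite /a2 /b2; case: ifP => _; lra.
have sub1 (x : 'rV[R]_n) : (forall i, a1 i <= x 0 i <= b1 i) -> Omega x.
  move=> xb; apply: near => i; have /andP[-> h1] := xb i.
  by apply: (le_trans h1); rewrite /b1; case: ifP => // _; rewrite lerDl ltW.
have sub2 (x : 'rV[R]_n) : (forall i, a2 i <= x 0 i <= b2 i) -> Omega x.
  move=> xb; apply: near => i; have /andP[h1 ->] := xb i; rewrite andbT.
  by apply: le_trans h1; rewrite /a2; case: ifP => // _; rewrite gerBl ltW.
have box_sub a b :
    (forall x : 'rV[R]_n, (forall i, a i <= x 0 i <= b i) -> Omega x) ->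
    box a b `<=` Omega.
  by move=> s x xb; apply: s => i; have /andP[/ltW -> /ltW ->] := xb i.
have t1 := test_function_bump sub1; have t2 := test_function_bump sub2.
have L1 := test_function_L2 t1; have L2' := test_function_L2 t2.
have disj x : bump a1 b1 x * bump a2 b2 x = 0.
  apply/eqP/negPn/negP; rewrite mulf_eq0 negb_or => /andP[].
  move=> /bump_neq0/(_ i0) /andP[_ +] /bump_neq0/(_ i0) /andP[+ _].
  by rewrite /b1 /a2 eqxx => p q; have := lt_trans p q; rewrite ltxx.
exists (fun v => L2inner Omega (v mi0) (bump a1 b1)); split.
  split=> [c u v su sv|].
    apply: L2inner_linl => //; first exact: sobolev0_L2_mi0 su.
    exact: sobolev0_L2_mi0 sv.
  exists (L2norm Omega (bump a1 b1)) => v sv.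
  have Lv := sobolev0_L2_mi0 sv.
  rewrite mulrC (le_trans (L2inner_le Lv L1))// ler_wpM2r ?L2norm_ge0//.
  by apply: L2norm_le_sobolev_norm; rewrite mi_order0.
move=> [c fc].
have E phi : test_function Omega phi ->
    L2inner Omega phi (bump a1 b1) = c * \int[leb R n]_(x in Omega) phi x.
  move=> tphi; have sphi := sobolev0_test tphi.
  have := fc _ sphi; rewrite (constant_functionalE M_gt0 Omega_bounded)// /mean.
  by rewrite /jet_of mi_deriv0.
have c0 : c = 0.
  have := E _ t2; rewrite L2innerC.
  have -> : L2inner Omega (bump a1 b1) (bump a2 b2) = 0.
    rewrite /L2inner /Rintegral integral0_eq// => x _.
    by rewrite disj.
  move/esym/eqP; rewrite mulf_eq0 => /orP[/eqP//|/eqP I0].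
  exfalso; apply: (bump_not_null ab2 (box_sub _ _ sub2)).
  by apply: nonneg_mean_eq0 => // x; exact: bump_ge0.
have := E _ t1; rewrite c0 mul0r -L2norm_sqr// => /eqP; rewrite sqrf_eq0 => /eqP.
move/(L2norm_eq0_ae L1); apply: bump_not_null => //; exact: box_sub.
Qed.

End nonconstant_functional.

(** * Assembly of the inequality and the identity *)

Lemma diameter_bounded (R : realType) n (Omega : set 'rV[R]_n) (d : R) x0 :
  diameter Omega = d%:E -> Omega x0 ->
  0 <= d /\ exists M, 0 < M /\ Omega `<=` cube M.
Proof.
move=> dE Ox0; have le_d x y : Omega x -> Omega y -> eucl_norm (x - y) <= d.
  move=> Ox Oy; rewrite -lee_fin -dE; apply: ereal_sup_ubound.
  by exists x => //; exists y.
have d0 : 0 <= d by apply: le_trans (le_d _ _ Ox0 Ox0); exact: sqrtr_ge0.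
(* Each coordinate is bounded by the Euclidean norm, hence by d after subtracting x0; the 1 gives
   strict inequalities for the open cube. *)
split => //; exists (d + `|x0| + 1); split.
  by rewrite ltr_wpDl// addr_ge0.
move=> x Ox i.
have xi : `|(x - x0) 0 i| <= d.
  apply: le_trans (le_d _ _ Ox Ox0); rewrite -sqrtr_sqr; apply: ler_wsqrtr.
  by rewrite (bigD1 i)//= lerDl sumr_ge0// => ? _; exact: sqr_ge0.
have x0i : `|x0 0 i| <= `|x0|.
  by rewrite [leRHS]mx_normrE; apply: (le_bigmax _ (fun ij => `|x0 ij.1 ij.2|) (0, i)).
rewrite -ltr_norml -[x](subrK x0) mxE (le_lt_trans (ler_normD _ _))//.
by rewrite ltr_pwDr// lerD.
Qed.

Theorem proposition1p3 (R : realType) (n : nat) (hn : (2 <= n)%N)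
  (Omega : set 'rV[R]_n) (diam : R) (c : 'rV[R]_n) (rho : R)
  (hdomain : domain Omega) (hdiam : diameter Omega = diam%:E)
  (hrho : 0 < rho) (hstar : star_shaped_wrt_ball Omega c rho)
  (CA CB CP : R) (hCA : 0 < CA) (hCB : 0 < CB) (hCP : 0 < CP)
  (hdiv : forall f : jet R n, sobolev0 Omega 1 f -> zero_mean Omega f ->
    exists u : 'I_n -> jet R n,
      [/\ vsobolev0 Omega 2 u,
          divergence u mi0 = f mi0 %[ae leb R n in Omega] &
          vseminorm Omega 2 u <=
            CA * L2norm Omega (f mi0) + CB * seminorm Omega 1 f])
  (hpoincare : forall f : jet R n, sobolev0 Omega 1 f ->
    L2norm Omega (f mi0) <= CP * diam * seminorm Omega 1 f) :
  (C_NL1 Omega <= (CA * CP * diam + CB)%:E)%E /\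
  C_NL1 Omega = ((beta1 Omega)^-1)%E.
Proof.
have [oO _ [x0 Ox0]] := hdomain.
have [d0 [M [M0 OM]]] := diameter_bounded hdiam Ox0.
set K := CA * CP * diam + CB.
have D0 : 0 <= CP * diam by rewrite mulr_ge0// ltW.
have K0 : 0 < K by rewrite ltr_wpDl// !mulr_ge0// ltW.
have hK v : sobolev0 Omega 1 v -> zero_mean Omega v ->
    exists u : 'I_n -> jet R n, [/\ vsobolev0 Omega 2 u,
      divergence u mi0 = v mi0 %[ae leb R n in Omega] &
      vseminorm Omega 2 u <= K * seminorm Omega 1 v].
  move=> sv mv; have [u [su uv ule]] := hdiv v sv mv; exists u; split => //.
  (* Poincaré turns the L^2 term of the hypothesis into C^A C_P R |v|_1, the first part of K. *)
  rewrite (le_trans ule)// /K mulrDl lerD2r -mulrA -mulrA ler_pM2l// mulrA.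
  exact: hpoincare.
have q_real f : dual_sobolev Omega 1 f -> nonconstant Omega f ->
    exists2 q, 0 < q & quotient_norm Omega f = q%:E.
  move=> hf nf; have q0 := quotient_norm_gt0 M0 OM hpoincare hf nf.
  have qy := quotient_norm_lty M0 OM D0 hpoincare hf.
  case: (quotient_norm Omega f) q0 qy => // q q0 _.
  by exists q; rewrite -?lte_fin.
have N_gt0 f : dual_sobolev Omega 1 f -> nonconstant Omega f ->
    (0 < vdual_norm Omega 2 (gradient f))%E.
  by move=> hf nf; exact: (vdual_norm_gt0 M0 OM D0 hpoincare hK hf nf).
split.
  apply: ge_ereal_sup => _ [f [hf nf] <-].
  have [q q0 qE] := q_real f hf nf; have := N_gt0 f hf nf.
  have := @quotient_norm_vdual_norm _ _ _ _ M0 OM _ D0 hpoincare _ K0 hK _ hf.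
  (* If the gradient has infinite norm, its inverse is 0 and the ratio is 0, which lies below K. *)
  case: (vdual_norm _ _ _) => [N||//]; last by rewrite invey mule0 lee_fin ltW.
  move=> h; rewrite lte_fin => N0; have := h N (ltW N0) erefl.
  rewrite qE inver gt_eqF// -EFinM !lee_fin ler_pdivrMr//.
  by rewrite mulrC.
(* The boxes carrying the two bumps are separated along coordinate 0, which exists because n is
   positive. *)
have [f0 [f0_dual f0_nc]] :=
  exists_nonconstant M0 OM (Ordinal (ltnW hn)) oO (ex_intro _ x0 Ox0).
have SE f : dual_sobolev Omega 1 f -> nonconstant Omega f ->
    let S := ereal_sup
      [set ((f (divergence u))%:E /
            (quotient_norm Omega f * (vseminorm Omega 2 u)%:E))%E
      | u in [set u | vsobolev0 Omega 2 u /\ vnonzero Omega u]] in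
    (0 <= S)%E /\
    (quotient_norm Omega f / vdual_norm Omega 2 (gradient f) = S^-1)%E.
  move=> hf nf; have [q q0 qE] := q_real f hf nf.
  rewrite (sup_divergence D0 hpoincare hf q0 qE) qE.
  have := N_gt0 f hf nf; case: (vdual_norm _ _ _) => [N|_|//]; last first.
    (* For infinite N the inner supremum N / q is +oo, whose inverse 0 equals q / N. *)
    by rewrite gt0_muley ?lte_fin ?invr_gt0// invey mule0.
  rewrite lte_fin => N0; rewrite -EFinM /= !inver !gt_eqF ?mulr_gt0 ?invr_gt0//.
  by rewrite lee_fin ltW ?mulr_gt0 ?invr_gt0// -EFinM invfM invrK.
rewrite /beta1 -ereal_sup_inve.
- congr ereal_sup; rewrite image_comp; apply/seteqP.
  by split=> _ [f [hf nf] <-]; exists f => //=; have [_ ->] := SE f hf nf.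
- by eexists; exists f0.
- by move=> _ [f [hf nf] <-]; exact: (SE f hf nf).1.
Qed.
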